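(* For each dimension $n\ge2$ there is a decreasing function $d:(0,\mu_n]\to\mathbb{R}_+$ with $\lim_{x\to0}d(x)=\infty$ such that a Margulis tube in a properly convex projective $n$-manifold with core geodesic of length less than $\epsilon$ has depth greater than $d(\epsilon)$.
   Context: A subset of $\mathbb{RP}^n$ is properly convex if every line meets it in a connected set and its closure is contained in an affine patch (complement of a hyperplane). A properly convex projective $n$-manifold is $M=\Omega/\Gamma$ with $\Omega\subset\mathbb{RP}^n$ nonempty, open, properly convex and $\Gamma$ a discrete torsion-free group of projective transformations preserving $\Omega$. It carries the Hilbert metric, induced from $d_\Omega(a,b)=\log\frac{\|b-x\|\|a-y\|}{\|b-y\|\|a-x\|}$, where $x,y\in\partial\overline\Omega$ are the endpoints of the segment through $a,b$ ($a$ between $x$ and $b$). $\operatorname{inj}(x)$ is the supremum of radii of embedded metric balls centered at $x$. $\mu_n>0$ is a fixed Margulis constant: there is an integer $m(n)$ such that for every properly convex projective $n$-manifold $M$ and $x\in M$ the subgroup of $\pi_1(M,x)$ generated by loops at $x$ of length less than $\mu_n$ contains a nilpotent subgroup of index at most $m(n)$; $\iota_n=3^{-(n+1)}\mu_n$. A Margulis tube is a tubular neighborhood $N$ of a simple closed geodesic (its core geodesic) in $M$ such that $\operatorname{inj}\ge\iota_n$ at every point of $\partial N$. The depth of a Margulis tube is the minimum distance of points on its boundary from the core geodesic. *)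

(* Defs.v *)
From HB Require Import structures.
From mathcomp Require Import all_boot all_order all_algebra generic_quotient.
From mathcomp Require Import all_classical all_reals all_analysis.

Set Implicit Arguments.
Unset Strict Implicit.
Unset Printing Implicit Defensive.

Import Order.TTheory GRing.Theory Num.Theory.
Import numFieldNormedType.Exports.

Local Open Scope classical_set_scope.
Local Open Scope quotient_scope.
Local Open Scope ring_scope.

Definition boundary (T : topologicalType) (A : set T) : set T :=
  closure A `\` interior A.

Definition enorm (R : realType) (n : nat) (v : 'rV[R]_n) : R :=
  Num.sqrt (\sum_i v 0 i ^+ 2).

Section ProjectiveSpace.
Context (R : realType) (n : nat).

Definition nzvec : Type := set_type [set v : 'rV[R]_n.+1 | v != 0].
HB.instance Definition _ := Topological.on nzvec.

Definition proportional (u v : nzvec) : bool :=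
  `[< exists2 a : R, a != 0 & val v = a *: val u >].

Lemma proportional_refl : reflexive proportional.
Proof. by move=> u; apply/asboolP; exists 1; rewrite ?oner_neq0 ?scale1r. Qed.

Lemma proportional_sym : symmetric proportional.
Proof.
suff H u v : proportional u v -> proportional v u.
  by move=> u v; apply/idP/idP; exact: H.
move=> /asboolP[a a0 e]; apply/asboolP; exists a^-1; first by rewrite invr_neq0.
by rewrite e scalerA mulVf ?scale1r.
Qed.

Lemma proportional_trans : transitive proportional.
Proof.
move=> v u w /asboolP[a a0 e] /asboolP[b b0 e']; apply/asboolP.
by exists (b * a); rewrite ?mulf_neq0 // e' e scalerA.
Qed.

Canonical proportional_equiv :=
  EquivRel proportional proportional_refl proportional_sym proportional_trans.

Definition RP : Type := quotient_topology {eq_quot proportional}.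
HB.instance Definition _ := Topological.on RP.
HB.instance Definition _ := Quotient.on RP.

Definition repr_vec (p : RP) : 'rV[R]_n.+1 := val (repr p : nzvec).

Definition projective_line (L : set RP) : Prop :=
  exists2 P : {vspace 'rV[R]_n.+1}, \dim P = 2%N &
    L = [set p | repr_vec p \in P].

(* The complement of the hyperplane {f = 0}, f being a linear form written as
   a column, with its affine coordinates: the representative on which f = 1. *)
Definition affine_patch (f : 'cV[R]_n.+1) : set RP :=
  [set p | repr_vec p *m f != 0].

Definition affine_coord (f : 'cV[R]_n.+1) (p : RP) : 'rV[R]_n.+1 :=
  ((repr_vec p *m f) 0 0)^-1 *: repr_vec p.

Definition properly_convex (O : set RP) : Prop :=
  (forall L, projective_line L -> connected (L `&` O)) /\
  (exists2 f : 'cV[R]_n.+1, f != 0 & closure O `<=` affine_patch f).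

Definition induces (A : 'M[R]_n.+1) (g : RP -> RP) : Prop :=
  A \in unitmx /\
  forall p, exists2 a : R, a != 0 & repr_vec (g p) = a *: (repr_vec p *m A).

Definition projective_transformation (g : RP -> RP) : Prop :=
  exists A, induces A g.

Definition is_transformation_group (G : set (RP -> RP)) : Prop :=
  [/\ forall g, G g -> projective_transformation g,
      G idfun,
      forall g h, G g -> G h -> G (g \o h) &
      forall g, G g -> exists h, [/\ G h, cancel g h & cancel h g]].

(* Discreteness in PGL(n+1, R) with the quotient topology of GL(n+1, R); the
   projection GL -> PGL is open. *)
Definition discrete_group (G : set (RP -> RP)) : Prop :=
  forall g A, G g -> induces A g ->
    \forall B \near A, forall h, G h -> induces B h -> h = g.

Definition torsion_free (G : set (RP -> RP)) : Prop :=
  forall g k, G g -> (0 < k)%N -> iter k g = idfun -> g = idfun.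

Definition hilbert_spec (O : set RP) (a b : RP) (r : R) : Prop :=
  (a = b /\ r = 0) \/
  (a <> b /\ exists (f : 'cV[R]_n.+1) (x y : RP) (s t : R),
    let u := affine_coord f in
    [/\ closure O `<=` affine_patch f,
        boundary (closure O) x /\ boundary (closure O) y,
        [/\ 0 < s, s < t & t < 1],
        u a = (1 - s) *: u x + s *: u y /\ u b = (1 - t) *: u x + t *: u y &
        r = ln ((enorm (u b - u x) * enorm (u a - u y)) /
                (enorm (u b - u y) * enorm (u a - u x)))]).

(* For O open and properly convex and a, b in O there is exactly one r with
   [hilbert_spec O a b r]: it does not depend on the affine patch f. *)
Definition hilbert (O : set RP) (a b : RP) : R :=
  xget 0 [set r | hilbert_spec O a b r].

Record pcManifold := PCManifold {
  pcm_domain : set RP;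
  pcm_group : set (RP -> RP);
  pcm_domain_nonempty : pcm_domain !=set0;
  pcm_domain_open : open pcm_domain;
  pcm_domain_properly_convex : properly_convex pcm_domain;
  pcm_is_group : is_transformation_group pcm_group;
  pcm_group_discrete : discrete_group pcm_group;
  pcm_group_torsion_free : torsion_free pcm_group;
  pcm_group_preserves : forall g, pcm_group g -> g @` pcm_domain = pcm_domain
}.

End ProjectiveSpace.

Section Manifold.
Context (R : realType) (n : nat) (M : pcManifold R n).

Definition domain_points : Type := set_type (pcm_domain M).
HB.instance Definition _ := Topological.on domain_points.

Definition orbit_rel (x y : domain_points) : bool :=
  `[< exists2 g, pcm_group M g & val y = g (val x) >].

Lemma orbit_rel_refl : reflexive orbit_rel.
Proof. by move=> x; apply/asboolP; exists idfun => //; case: (pcm_is_group M). Qed.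

Lemma orbit_rel_sym : symmetric orbit_rel.
Proof.
suff H x y : orbit_rel x y -> orbit_rel y x.
  by move=> x y; apply/idP/idP; exact: H.
move=> /asboolP[g Gg e]; apply/asboolP.
have [_ _ _ /(_ g Gg)[h [Gh gh _]]] := pcm_is_group M.
by exists h; rewrite // e gh.
Qed.

Lemma orbit_rel_trans : transitive orbit_rel.
Proof.
move=> y x z /asboolP[g Gg e] /asboolP[h Gh e']; apply/asboolP.
have [_ _ /(_ h g Gh Gg) Ghg _] := pcm_is_group M.
by exists (h \o g); rewrite //= e' e.
Qed.

Canonical orbit_equiv :=
  EquivRel orbit_rel orbit_rel_refl orbit_rel_sym orbit_rel_trans.

Definition orbit_space : Type := quotient_topology {eq_quot orbit_rel}.
HB.instance Definition _ := Topological.on orbit_space.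
HB.instance Definition _ := Quotient.on orbit_space.

Definition orbit_proj (x : domain_points) : orbit_space := \pi_orbit_space x.

Definition hilbert_dist (x y : domain_points) : R :=
  hilbert (pcm_domain M) (val x) (val y).

Definition quotient_dist (x y : orbit_space) : R :=
  inf [set r | exists a b : domain_points,
                 [/\ orbit_proj a = x, orbit_proj b = y & r = hilbert_dist a b]].

(* A metric ball of M centered at x is embedded when the ball of the same
   radius about a lift of x projects injectively to M. *)
Definition embedded_ball (x : orbit_space) (r : R) : Prop :=
  exists2 a : domain_points, orbit_proj a = x &
    {in [set y | hilbert_dist a y < r] &, injective orbit_proj}.

Definition inj_radius (x : orbit_space) : \bar R :=
  ereal_sup [set r%:E | r in [set r | 0 < r /\ embedded_ball x r]].

Definition curve_length (f : R -> orbit_space) : \bar R :=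
  ereal_sup [set (\sum_(p <- zip (0 :: s) s) quotient_dist (f p.1) (f p.2))%:E
            | s in [set s | itv_partition 0 1 s]].

Definition is_loop (x : orbit_space) (f : R -> orbit_space) : Prop :=
  [/\ {within `[0, 1], continuous f}, f 0 = x & f 1 = x].

Definition loop_homotopic (x : orbit_space) (f g : R -> orbit_space) : Prop :=
  exists H : R * R -> orbit_space,
    [/\ {within `[0, 1] `*` `[0, 1], continuous H},
        forall t, t \in `[0, 1] -> H (t, 0) = f t,
        forall t, t \in `[0, 1] -> H (t, 1) = g t &
        forall s, s \in `[0, 1] -> H (0, s) = x /\ H (1, s) = x].

Definition loop_concat (f g : R -> orbit_space) : R -> orbit_space :=
  fun t => if t <= 2^-1 then f (2 * t) else g (2 * t - 1).

Definition loop_reverse (f : R -> orbit_space) : R -> orbit_space :=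
  fun t => f (1 - t).

(* Elements of the fundamental group at x are homotopy classes of loops, i.e.
   sets of the form [loop_class x f]. *)
Definition loop_class (x : orbit_space) (f : R -> orbit_space) :
    set (R -> orbit_space) :=
  [set g | is_loop x g /\ loop_homotopic x f g].

Definition pi1_one (x : orbit_space) : set (R -> orbit_space) :=
  loop_class x (cst x).

Definition pi1_mul (x : orbit_space) (a b : set (R -> orbit_space)) :
    set (R -> orbit_space) :=
  [set h | exists f g, [/\ a f, b g & loop_class x (loop_concat f g) h]].

Definition pi1_inv (x : orbit_space) (a : set (R -> orbit_space)) :
    set (R -> orbit_space) :=
  [set h | exists2 f, a f & loop_class x (loop_reverse f) h].

End Manifold.

Section Groups.
Context (T : Type) (mul : T -> T -> T) (inv : T -> T) (one : T).

Definition is_subgroup (H : set T) : Prop :=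
  [/\ H one, forall a b, H a -> H b -> H (mul a b) &
      forall a, H a -> H (inv a)].

Definition generated (S : set T) : set T := smallest is_subgroup S.

Definition commutator (a b : T) : T := mul (mul (inv a) (inv b)) (mul a b).

Fixpoint lower_central (H : set T) (k : nat) : set T :=
  if k is k'.+1 then
    generated [set commutator a b | a in lower_central H k' & b in H]
  else H.

Definition nilpotent_subgroup (H : set T) : Prop :=
  is_subgroup H /\ exists k, lower_central H k `<=` [set one].

Definition index_at_most (H K : set T) (m : nat) : Prop :=
  exists r : 'I_m -> T,
    forall h, H h -> exists i, exists2 k, K k & h = mul (r i) k.

End Groups.

Definition short_loops (R : realType) (n : nat) (M : pcManifold R n)
    (x : orbit_space M) (mu : R) : set (set (R -> orbit_space M)) :=
  [set loop_class x f |
    f in [set f | is_loop x f /\ (curve_length f < mu%:E)%E]].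

Definition short_subgroup (R : realType) (n : nat) (M : pcManifold R n)
    (x : orbit_space M) (mu : R) : set (set (R -> orbit_space M)) :=
  generated (pi1_mul x) (pi1_inv x) (pi1_one x) (short_loops x mu).

Definition margulis_constant (R : realType) (n : nat) (mu : R) : Prop :=
  0 < mu /\ exists m : nat, forall (M : pcManifold R n) (x : orbit_space M),
    exists K : set (set (R -> orbit_space M)),
      [/\ K `<=` short_subgroup x mu,
          nilpotent_subgroup (pi1_mul x) (pi1_inv x) (pi1_one x) K &
          index_at_most (pi1_mul x) (short_subgroup x mu) K m].

Definition iota_margulis (R : realType) (n : nat) (mu : R) : R :=
  mu / 3 ^+ n.+1.

Section Tubes.
Context (R : realType) (n : nat) (M : pcManifold R n).

(* c is parametrized by arc length and has length l. A geodesic is a curve that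
   lifts to a segment of a projective line: minimizing curves of a Hilbert
   metric need not be straight when the domain is not strictly convex. *)
Definition simple_closed_geodesic (c : R -> orbit_space M) (l : R) : Prop :=
  [/\ 0 < l,
      exists (L : set (RP R n)) (c' : R -> domain_points M),
        [/\ projective_line L, forall t, L (val (c' t)),
            forall s t, hilbert_dist (c' s) (c' t) = `|s - t| &
            forall t, c t = orbit_proj (c' t)] &
      forall s t, c s = c t <-> exists k : int, s = t + k%:~R * l].

(* The disc bundle over the circle with monodromy A is the quotient of
   D^(n-1) x R by the powers of [bundle_shift A]. *)
Definition disc_bundle : set ('rV[R]_n.-1 * R) := [set p | enorm p.1 <= 1].

Definition bundle_shift (A : 'M[R]_n.-1) (p : 'rV[R]_n.-1 * R) :
  'rV[R]_n.-1 * R := (p.1 *m A, p.2 + 1).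

Definition bundle_rel (A : 'M[R]_n.-1) (p q : 'rV[R]_n.-1 * R) : Prop :=
  exists k : nat,
    q = iter k (bundle_shift A) p \/ p = iter k (bundle_shift A) q.

(* N is the image of an embedded closed disc bundle whose zero section is c;
   the bundle being compact, a continuous injection is an embedding. *)
Definition tubular_neighborhood (N : set (orbit_space M)) (c : R -> orbit_space M)
    (l : R) : Prop :=
  range c `<=` interior N /\
  exists (A : 'M[R]_n.-1) (phi : 'rV[R]_n.-1 * R -> orbit_space M),
    [/\ A *m A^T = 1%:M,
        {within disc_bundle, continuous phi},
        forall p q, disc_bundle p -> disc_bundle q ->
          (phi p = phi q <-> bundle_rel A p q),
        forall t, phi (0, t) = c (l * t) &
        phi @` disc_bundle = N].

Definition margulis_tube (mu : R) (N : set (orbit_space M))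
    (c : R -> orbit_space M) (l : R) : Prop :=
  [/\ simple_closed_geodesic c l, tubular_neighborhood N c l &
      forall x, boundary N x -> ((iota_margulis n mu)%:E <= inj_radius x)%E].

(* Both boundary N and the core are compact, so that this is a minimum as soon
   as boundary N is nonempty. *)
Definition depth (N : set (orbit_space M)) (c : R -> orbit_space M) : \bar R :=
  ereal_inf [set (quotient_dist x y)%:E | x in boundary N & y in range c].

End Tubes.

(* Main.v *)
Require Import Defs.
From mathcomp Require Import all_boot all_order all_algebra generic_quotient.
From mathcomp Require Import all_classical all_reals all_analysis.
From mathcomp Require Import ring lra.
Import Order.TTheory GRing.Theory Num.Theory.
Import numFieldNormedType.Exports.
Local Open Scope classical_set_scope.
Local Open Scope quotient_scope.
Local Open Scope ring_scope.

Set Implicit Arguments.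
Unset Strict Implicit.
Unset Printing Implicit Defensive.

(** Let [K] be the convex cone over [Omega] in [R^(n+1)]. By Birkhoff's formula,
    the Hilbert distance of [v] and [w] in [K] is the infimum of [log (a b)] over
    the [a, b > 0] with [a w - v] and [b v - w] in [K].

    Suppose that a point [x] is within [D] of a lift [p] of a point of the core,
    and let [g] be the deck transformation moving [p] by the length [l] of the
    core. If [l] is small, the points [x, g x, ..., g^N x] all lie in the ball of
    radius [D + 1] about [p]. In the norm whose unit ball is the order interval
    [-p, p] this ball is bounded, and boxes in coordinates with respect to a
    basis of maximal determinant show that, for [N] depending on [D] and [n]
    only, two of these points are close. Hence some power of [g] moves [x] by
    less than [iota_n], so [inj x < iota_n] and [x] is not over the boundary of
    the tube.

    That gives a depth tending to infinity as [l] tends to [0]; that the depth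
    of every single tube is positive follows from compactness of the core. *)

(** * Points of projective space and nonzero vectors *)

Section ProjectivePoints.
Context {R : realType} {n : nat}.
Implicit Types (v w : 'rV[R]_n.+1) (p q : RP R n).

Lemma ones_neq0 : (const_mx 1 : 'rV[R]_n.+1) \in [set v | v != 0].
Proof.
apply/mem_set/eqP => /matrixP/(_ 0 0); rewrite !mxE => /eqP.
by rewrite oner_eq0.
Qed.

Definition nz_ones : nzvec R n :=
  exist (fun v => v \in [set v | v != 0]) (const_mx 1) ones_neq0.

(** The zero vector gets a junk value, the class of the all-ones vector, which makes [cl] total. *)
Definition cl v : RP R n :=
  \pi_(RP R n) (insubd nz_ones v).

Lemma repr_vec_neq0 p : repr_vec p != 0.
Proof. by rewrite /repr_vec; case: (repr p) => v /= /set_mem. Qed.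

Lemma pi_repr_vec (u : nzvec R n) :
  exists2 a : R, a != 0 & repr_vec (\pi_(RP R n) u) = a *: val u.
Proof.
have e : u = repr (\pi_(RP R n) u) %[mod {eq_quot (@proportional R n)}].
  by rewrite -[RHS]/(\pi_(RP R n) _) reprK.
by move/eqmodP: e => /asboolP.
Qed.

Lemma val_insubd_nz (u : nzvec R n) v : v != 0 -> val (insubd u v) = v.
Proof. by move=> v0; rewrite insubdK//; exact/mem_set. Qed.

Lemma repr_cl v : v != 0 -> exists2 a : R, a != 0 & repr_vec (cl v) = a *: v.
Proof.
move=> v0; have [a a0] := pi_repr_vec (insubd nz_ones v).
by rewrite val_insubd_nz// => e; exists a.
Qed.

Lemma cl_pi (u : nzvec R n) : cl (val u) = \pi_(RP R n) u.
Proof. by rewrite /cl valKd. Qed.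

Lemma cl_repr p : cl (repr_vec p) = p.
Proof. by rewrite /repr_vec cl_pi reprK. Qed.

Lemma clZ (a : R) v : a != 0 -> cl (a *: v) = cl v.
Proof.
move=> a0; have [->|v0] := eqVneq v 0; first by rewrite scaler0.
have av0 : a *: v != 0 by rewrite scaler_eq0 negb_or a0.
apply/eqmodP/asboolP; exists a^-1; first by rewrite invr_eq0.
by rewrite !val_insubd_nz// scalerA mulVf// scale1r.
Qed.

Lemma cl_inj v w : v != 0 -> w != 0 -> cl v = cl w ->
  exists2 a : R, a != 0 & w = a *: v.
Proof.
move=> v0 w0 e; have [a a0 ea] := repr_cl v0; have [b b0 eb] := repr_cl w0.
exists (b^-1 * a); first by rewrite mulf_neq0 ?invr_eq0.
by rewrite -scalerA -ea e eb scalerA mulVf// scale1r.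
Qed.

Lemma neq0_open : open [set v : 'rV[R]_n.+1 | v != 0].
Proof.
rewrite (_ : [set v | v != 0] = ~` [set 0]).
  apply: closed_openC; apply: (@accessible_closed_set1 'rV[R]_n.+1).
  exact: hausdorff_accessible (@norm_hausdorff _ _).
by apply/seteqP; split => v /=; [move=> /eqP|move=> /eqP].
Qed.

Lemma cl_open (U : set (RP R n)) : open U -> open [set v | v != 0 /\ U (cl v)].
Proof.
move=> oU; have : open ((\pi_(RP R n) : nzvec R n -> _) @^-1` U) by [].
move=> [W oW e].
rewrite (_ : [set v | _] = W `&` [set v | v != 0]).
  by apply: openI => //; exact: neq0_open.
apply/seteqP; split => v /=.
  move=> [v0 Uv]; split => //.
  pose u : nzvec R n := exist (fun v => v \in [set v | v != 0]) v (mem_set v0).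
  by have : (set_val @^-1` W) u by rewrite e /= -cl_pi.
move=> [Wv v0]; split => //.
pose u : nzvec R n := exist (fun v => v \in [set v | v != 0]) v (mem_set v0).
have : ((\pi_(RP R n) : nzvec R n -> _) @^-1` U) u by rewrite -e.
by rewrite /= -cl_pi.
Qed.

Lemma scaleset_open (W : set 'rV[R]_n.+1) (a : R) : open W ->
  open [set v | W (a *: v)].
Proof.
move=> oW; rewrite -[X in open X]/((fun v : 'rV[R]_n.+1 => a *: v) @^-1` W).
by apply: open_comp => // v _; exact: scaler_continuous.
Qed.

(** The preimage among nonzero vectors is the union of the rescaled copies of [W]. This is how open
    sets of the quotient topology are produced from open sets of vectors. *)
Lemma saturation_open (W : set 'rV[R]_n.+1) : open W ->
  open [set p : RP R n | exists2 a : R, a != 0 & W (a *: repr_vec p)].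
Proof.
move=> oW.
suff : open ((\pi_(RP R n) : nzvec R n -> _) @^-1`
  [set p : RP R n | exists2 a : R, a != 0 & W (a *: repr_vec p)]) by [].
exists (\bigcup_(a in [set a : R | a != 0]) [set v | W (a *: v)]).
  by apply: bigcup_open => a _; exact: scaleset_open.
apply/seteqP; split => u /=; have [b b0 ->] := pi_repr_vec u.
  move=> [a a0 Wa]; exists (a / b); first by rewrite mulf_neq0// invr_eq0.
  by rewrite scalerA divfK.
move=> [a a0]; rewrite scalerA => ?; exists (a * b) => //.
exact: mulf_neq0.
Qed.

Lemma nbhs_cl v (U : set (RP R n)) : v != 0 -> nbhs (cl v) U ->
  \forall w \near v, w != 0 /\ U (cl w).
Proof.
move=> v0; rewrite nbhsE => -[V [oV Vv] VU].
have := cl_open oV; rewrite openE => /(_ v (conj v0 Vv)).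
by apply: filterS => w [w0 /VU].
Qed.

(** The projection from nonzero vectors is continuous and open, so taking preimages commutes with
    closure. *)
Lemma closure_cl (O : set (RP R n)) v : v != 0 ->
  closure O (cl v) <-> closure [set w | w != 0 /\ O (cl w)] v.
Proof.
move=> v0; split => [cO W|cC U /(nbhs_cl v0) Uv].
  rewrite nbhsE => -[W' [oW' W'v] W'W].
  have [|q [Oq [a a0 Wa]]] := cO [set p | exists2 a : R, a != 0 & W' (a *: repr_vec p)].
  - apply: open_nbhs_nbhs; split; first exact: saturation_open.
    rewrite /=.
    have [a a0 ->] := repr_cl v0; exists a^-1; first by rewrite invr_eq0.
    by rewrite scalerA mulVf// scale1r.
  - exists (a *: repr_vec q); split; last exact: W'W.
    by rewrite /= scaler_eq0 negb_or a0 repr_vec_neq0 clZ// cl_repr.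
by have [w [[w0 Ow] [_ Uw]]] := cC _ Uv; exists (cl w).
Qed.

End ProjectivePoints.

(** * Proper convex cones *)

Section LinearForm.
Context {R : realType} {m : nat}.
Implicit Types (f : 'cV[R]_m) (v w : 'rV[R]_m).

Definition lform f v : R := (v *m f) 0 0.

Lemma lformD f v w : lform f (v + w) = lform f v + lform f w.
Proof. by rewrite /lform mulmxDl mxE. Qed.

Lemma lformZ f a v : lform f (a *: v) = a * lform f v.
Proof. by rewrite /lform -scalemxAl mxE. Qed.

Lemma lformB f v w : lform f (v - w) = lform f v - lform f w.
Proof. by rewrite -scaleN1r lformD lformZ mulN1r. Qed.

Lemma lform0 f : lform f 0 = 0.
Proof. by rewrite /lform mul0mx mxE. Qed.

Lemma lformN f v : lform (- f) v = - lform f v.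
Proof. by rewrite /lform mulmxN mxE. Qed.

Lemma lform_continuous f : continuous (lform f).
Proof.
rewrite (_ : lform f = fun v => \sum_i v 0 i * f i 0); last first.
  by apply/funext => v; rewrite /lform mxE.
apply: continuous_big; first exact: add_continuous.
move=> i _ v.
have cv : (u : 'rV[R]_m) 0 i @[u --> v] --> v 0 i by exact: coord_continuous.
exact: (cvgM cv (cvg_cst (f i 0))).
Qed.

End LinearForm.

Section Cone.
Context {R : realType} {n : nat}.
Local Notation V := 'rV[R]_n.+1.

(** The form [f] is carried along as a witness of properness: its positivity on the closure away
    from the origin makes the slice where [f] equals 1 bounded. *)
Record proper_cone (K : set V) (f : 'cV[R]_n.+1) : Prop := ProperCone {
  cone_open : open K;
  coneD : forall v w, K v -> K w -> K (v + w);
  coneZ : forall (a : R) v, 0 < a -> K v -> K (a *: v);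
  cone_gt0 : forall v, K v -> 0 < lform f v;
  closure_cone_gt0 : forall v, closure K v -> v != 0 -> 0 < lform f v }.

(** Birkhoff's description of Hilbert distance less than [ln rho]; see [hilbert_ltP]. The strictness
    comes from asking for membership in the open cone instead of its closure. *)
Definition cone_near (K : set V) (v w : V) (rho : R) : Prop :=
  exists a b : R, [/\ 0 < a, 0 < b, K (a *: w - v), K (b *: v - w) & a * b <= rho].

Context (K : set V) (f : 'cV[R]_n.+1) (hK : proper_cone K f).

Lemma cone_neq0 v : K v -> v != 0.
Proof. by move=> /(cone_gt0 hK); apply: contraTneq => ->; rewrite lform0 ltxx. Qed.

(** Openness leaves room to replace [w] by a nearby [u] in [K] with [v + w - u] still in [K]. *)
Lemma coneD_closure v w : K v -> closure K w -> K (v + w).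
Proof.
move=> Kv cw; have : nbhs w [set u | K (v + w - u)].
  apply: open_nbhs_nbhs; split; last by rewrite /= addrK.
  rewrite -[X in open X]/((fun u => v + w - u) @^-1` K).
  apply: open_comp; last exact: cone_open hK.
  by move=> u _; exact: (cvgB (cvg_cst (v + w)) (@cvg_id _ (nbhs u))).
by move=> /cw[u [Ku /(coneD hK Ku)]]; rewrite addrC subrK.
Qed.

Lemma coneDZ_closure v w (c : R) : K v -> closure K w -> 0 <= c -> K (v + c *: w).
Proof.
move=> Kv cw; rewrite le_eqVlt => /predU1P[<-|c0]; first by rewrite scale0r addr0.
rewrite -[v]scale1r -(mulfV (lt0r_neq0 c0)) -scalerA -scalerDr.
apply: (coneZ hK) => //; apply: coneD_closure => //.
by apply: (coneZ hK) => //; rewrite invr_gt0.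
Qed.

Lemma coneDZ v w (c : R) : K v -> K w -> 0 <= c -> K (v + c *: w).
Proof. by move=> Kv /(@subset_closure _ K); exact: coneDZ_closure. Qed.

(** If [g] were positive at [v] and negative at [w], a positive combination of the two, which lies
    in [K], would be a zero of [g]. *)
Lemma cone_form_sign (g : 'cV[R]_n.+1) : (forall v, K v -> lform g v != 0) ->
  (forall v, K v -> 0 < lform g v) \/ (forall v, K v -> 0 < lform (- g) v).
Proof.
move=> g0.
have same v w : K v -> K w -> 0 < lform g v -> 0 < lform g w.
  move=> Kv Kw gv; rewrite ltNge le_eqVlt (negbTE (g0 w Kw)) /=; apply/negP => gw.
  have Kvw : K (- lform g w *: v + lform g v *: w).
    by apply: (coneD hK); apply: (coneZ hK); rewrite ?oppr_gt0.
  by have := g0 _ Kvw; rewrite lformD !lformZ mulNr [X in _ + X]mulrC addNr eqxx.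
have [[v [Kv gv]]|h] := pselect (exists v, K v /\ 0 < lform g v).
  by left => w Kw; exact: same Kv Kw gv.
right => v Kv; rewrite lformN oppr_gt0 lt_neqAle g0//= leNgt; apply/negP => gv.
by apply: h; exists v.
Qed.

(** The constant is the minimum of [f] over the compact set of unit vectors in the closure of [K].
    If that set is empty, so is [K]. *)
Lemma cone_norm_le : exists2 m : R, 0 < m & forall v, K v -> m * `|v| <= lform f v.
Proof.
pose S := closure K `&` [set v | `|v| = 1].
have KS v : K v -> S (`|v|^-1 *: v).
  move=> Kv; have v0 := cone_neq0 Kv; split.
    by apply: subset_closure; apply: (coneZ hK) => //; rewrite invr_gt0 normr_gt0.
  by rewrite /= normrZ ger0_norm ?invr_ge0// mulVf// normr_eq0.
have [S0|S0] := pselect (S !=set0); last first.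
  by exists 1 => // v /KS Sv; exfalso; apply: S0; eexists; exact: Sv.
have cS : compact S.
  apply: bounded_closed_compact.
    exists 1; split => // x x1 v [_ /= ->]; exact: ltW.
  apply: closedI; first exact: closed_closure.
  rewrite -[X in closed X]/(Num.norm @^-1` [set 1]).
  apply: preimage_closed; first by move=> ? _; exact: norm_continuous.
  exact: closed_eq.
have [|c /set_mem[cc c1] cmin] := @EVT_min_rV R n.+1 (lform f) S S0 cS.
  by apply: continuous_subspaceT => v; exact: lform_continuous.
exists (lform f c).
  by apply: (closure_cone_gt0 hK) => //; rewrite -normr_eq0 c1 oner_eq0.
move=> v Kv; have v0 : 0 < `|v| by rewrite normr_gt0 cone_neq0.
have := cmin _ (mem_set (KS _ Kv)); rewrite lformZ.
by rewrite ler_pdivlMl// mulrC.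
Qed.

Lemma cone_near_refl v rho : K v -> 1 < rho -> cone_near K v v rho.
Proof.
move=> Kv r1; have s1 : 1 < Num.sqrt rho by rewrite -sqrtr1 ltr_sqrt// (lt_trans _ r1).
exists (Num.sqrt rho), (Num.sqrt rho).
have Ks : K (Num.sqrt rho *: v - v).
  by rewrite -[X in _ - X]scale1r -scalerBl; apply: (coneZ hK); rewrite ?subr_gt0.
split; rewrite ?(lt_trans _ s1)//.
by rewrite -expr2 sqr_sqrtr// ltW// (lt_trans _ r1).
Qed.

Lemma cone_near_sym v w rho : cone_near K v w rho -> cone_near K w v rho.
Proof. by move=> [a [b [a0 b0 ? ? ?]]]; exists b, a; split => //; rewrite mulrC. Qed.

Lemma cone_near_trans u v w rho sigma :
  cone_near K u v rho -> cone_near K v w sigma -> cone_near K u w (rho * sigma).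
Proof.
move=> [a [b [a0 b0 Ka Kb ab]]] [c [d [c0 d0 Kc Kd cd]]].
exists (a * c), (d * b); split; rewrite ?mulr_gt0//.
- rewrite (_ : _ - u = a *: (c *: w - v) + (a *: v - u)).
    by apply: (coneD hK) => //; exact: (coneZ hK).
  by rewrite scalerBr scalerA addrA subrK.
- rewrite (_ : _ - w = d *: (b *: u - v) + (d *: v - w)).
    by apply: (coneD hK) => //; exact: (coneZ hK).
  by rewrite scalerBr scalerA addrA subrK.
- rewrite (_ : _ * _ = (a * b) * (c * d)); last by ring.
  by apply: ler_pM => //; rewrite ltW// mulr_gt0.
Qed.

Lemma cone_nearZ v w rho (c d : R) : 0 < c -> 0 < d ->
  cone_near K v w rho -> cone_near K (c *: v) (d *: w) rho.
Proof.
move=> c0 d0 [a [b [a0 b0 Ka Kb ab]]].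
exists (c * a / d), (d * b / c); split; rewrite ?divr_gt0 ?mulr_gt0//.
- rewrite scalerA divfK ?gt_eqF// -scalerA -scalerBr; exact: (coneZ hK).
- rewrite scalerA divfK ?gt_eqF// -scalerA -scalerBr; exact: (coneZ hK).
- rewrite (_ : _ * _ = a * b)//; field.
  by rewrite !gt_eqF.
Qed.

Lemma cone_near_map (A : 'M[R]_n.+1) v w rho :
  (forall u, K u -> K (u *m A)) ->
  cone_near K v w rho -> cone_near K (v *m A) (w *m A) rho.
Proof.
move=> KA [a [b [a0 b0 Ka Kb ab]]]; exists a, b; split => //.
- by rewrite scalemxAl -mulmxBl; exact: KA.
- by rewrite scalemxAl -mulmxBl; exact: KA.
Qed.

(** The plane through [x] and [y] meets [K] in an open quadrant: if a coefficient were nonpositive,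
    adding a multiple of that endpoint would remove it and put the other endpoint into [K]. *)
Lemma cone_seg (x y : V) (s a b : R) :
  closure K x -> closure K y -> ~ K x -> ~ K y ->
  lform f x = 1 -> lform f y = 1 -> 0 < s -> s < 1 ->
  K ((1 - s) *: x + s *: y) ->
  K (a *: x + b *: y) <-> 0 < a /\ 0 < b.
Proof.
move=> cx cy nx ny fx fy s0 s1 Ks; split.
  move=> Kab; have := cone_gt0 hK Kab; rewrite lformD !lformZ fx fy !mulr1 => ab0.
  split; rewrite ltNge; apply/negP => h.
    have b0 : 0 < b by lra.
    apply: ny; rewrite (_ : y = b^-1 *: ((a *: x + b *: y) + (- a) *: x)).
      apply: (coneZ hK); rewrite ?invr_gt0//; apply: coneDZ_closure => //; lra.
    by rewrite scaleNr addrAC subrr add0r scalerA mulVf ?scale1r// gt_eqF.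
  have a0 : 0 < a by lra.
  apply: nx; rewrite (_ : x = a^-1 *: ((a *: x + b *: y) + (- b) *: y)).
    apply: (coneZ hK); rewrite ?invr_gt0//; apply: coneDZ_closure => //; lra.
  by rewrite scaleNr addrK scalerA mulVf ?scale1r// gt_eqF.
(* Subtracting [c] times the given point of [K] leaves nonnegative coefficients, because [s] and
   [1 - s] are at most 1. *)
move=> [a0 b0]; pose c := Num.min a b.
have c0 : 0 < c by rewrite lt_min a0.
have ca : c <= a by rewrite ge_min lexx.
have cb : c <= b by rewrite ge_min lexx orbT.
rewrite (_ : _ + _ = c *: ((1 - s) *: x + s *: y) + (a - c * (1 - s)) *: x
    + (b - c * s) *: y); last by apply/rowP => i; rewrite !mxE; ring.
apply: coneDZ_closure => //; last by rewrite subr_ge0; nra.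
apply: coneDZ_closure => //; last by rewrite subr_ge0; nra.
exact: (coneZ hK).
Qed.

(** By [cone_seg] the two memberships become [a > (1 - s) / (1 - t)] and [b > t / s], the other two
    inequalities being weaker; the product of these bounds is the cross-ratio. *)
Lemma cone_near_seg (x y : V) (s t rho : R) :
  closure K x -> closure K y -> ~ K x -> ~ K y ->
  lform f x = 1 -> lform f y = 1 -> 0 < s -> s < t -> t < 1 ->
  K ((1 - s) *: x + s *: y) ->
  cone_near K ((1 - s) *: x + s *: y) ((1 - t) *: x + t *: y) rho <->
  (t * (1 - s)) / (s * (1 - t)) < rho.
Proof.
move=> cx cy nx ny fx fy s0 st t1 Ks.
have s1 := lt_trans st t1.
have t0 := lt_trans s0 st.
have t10 : 0 < 1 - t by rewrite subr_gt0.
have s10 : 0 < 1 - s by rewrite subr_gt0.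
have seg a b := cone_seg a b cx cy nx ny fx fy s0 s1 Ks.
have e1 a : a *: ((1 - t) *: x + t *: y) - ((1 - s) *: x + s *: y) =
   (a * (1 - t) - (1 - s)) *: x + (a * t - s) *: y.
  by apply/rowP => i; rewrite !mxE; ring.
have e2 a : a *: ((1 - s) *: x + s *: y) - ((1 - t) *: x + t *: y) =
   (a * (1 - s) - (1 - t)) *: x + (a * s - t) *: y.
  by apply/rowP => i; rewrite !mxE; ring.
split.
  move=> [a [b [a0 b0]]]; rewrite e1 e2 => /seg[a1 _] /seg[_ b1]; apply: lt_le_trans.
  rewrite ltr_pdivrMr ?mulr_gt0// (_ : a * b * _ = (b * s) * (a * (1 - t))); last by ring.
  by apply: ltr_pM; rewrite ?(ltW t0) ?(ltW s10)//; lra.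
move=> hr; pose q := t * (1 - s) / (s * (1 - t)).
have q1 : 0 < q by rewrite divr_gt0 ?mulr_gt0.
have rho0 := lt_trans q1 hr.
(* The surplus factor [rho / q] is shared equally between the two scalars. *)
pose k := Num.sqrt (rho / q).
have rq1 : 1 < rho / q by rewrite ltr_pdivlMr// mul1r.
have k1 : 1 < k by rewrite -sqrtr1 ltr_sqrt// (lt_trans _ rq1).
have k0 := lt_trans ltr01 k1.
have kk : k * k = rho / q by rewrite -expr2 sqr_sqrtr// ltW// divr_gt0.
have a1 : k * ((1 - s) / (1 - t)) * (1 - t) = k * (1 - s).
  by rewrite -mulrA divfK// gt_eqF.
have b1 : k * (t / s) * s = k * t by rewrite -mulrA divfK// gt_eqF.
exists (k * ((1 - s) / (1 - t))), (k * (t / s)); split.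
- by rewrite mulr_gt0// divr_gt0.
- by rewrite mulr_gt0// divr_gt0.
- rewrite e1; apply/seg; rewrite a1 !subr_gt0; split; first by rewrite ltr_pMl.
  apply: (@lt_trans _ _ (k * s)); first by rewrite ltr_pMl.
  rewrite -mulrA ltr_pM2l// mulrAC ltr_pdivlMr//; nra.
- rewrite e2; apply/seg; rewrite b1 !subr_gt0; split; last by rewrite ltr_pMl.
  apply: (@lt_trans _ _ (k * (1 - t))); first by rewrite ltr_pMl.
  rewrite -mulrA ltr_pM2l// mulrAC ltr_pdivlMr//; nra.
- rewrite mulrACA kk [X in _ * X](_ : _ = q) ?divfK ?gt_eqF//.
  by rewrite /q; field; rewrite !gt_eqF.
Qed.

End Cone.

Section ConeTopology.
Context {R : realType} {n : nat}.
Local Notation V := 'rV[R]_n.+1.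
Context (K : set V) (f : 'cV[R]_n.+1) (hK : proper_cone K f).

Lemma affine_line_continuous (v d : V) : continuous (fun t : R => v + t *: d).
Proof.
move=> t; apply: (@cvgD _ _ _ _ _ (fun=> v) (fun t => t *: d)); first exact: cvg_cst.
exact: scalel_continuous.
Qed.

Lemma affine_map_continuous (v : V) (a b : R) :
  continuous (fun w : V => a *: w + b *: v).
Proof.
move=> w; have h : a *: u @[u --> w] --> a *: w by exact: scaler_continuous.
exact: (cvgD h (cvg_cst (b *: v))).
Qed.

(** The exit time is the supremum of the times spent in [K]. It is finite because [f] is constant
    along the line, so that [cone_norm_le] bounds the points of the line in [K]. *)
Lemma cone_exit (v d : V) : K v -> d != 0 -> lform f d = 0 ->
  exists tau : R, [/\ 0 < tau, closure K (v + tau *: d),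
    forall t, tau < t -> ~ closure K (v + t *: d) &
    forall t, 0 <= t -> t < tau -> K (v + t *: d)].
Proof.
move=> Kv d0 fd; have [m m0 hm] := cone_norm_le hK.
have nd0 : 0 < `|d| by rewrite normr_gt0.
pose T := [set t : R | 0 <= t /\ K (v + t *: d)].
have T0 : T 0 by rewrite /T /= scale0r addr0.
have hT : has_sup T.
  split; first by exists 0.
  exists ((lform f v / m + `|v|) / `|d|) => t [t0 /hm].
  rewrite lformD lformZ fd mulr0 addr0 -ler_pdivlMl// => h.
  rewrite ler_pdivlMr// -[t in t * _]ger0_norm// -normrZ mulrC.
  rewrite -[_ *: d](addKr v) (le_trans (ler_normD _ _))// normrN addrC lerD2r//.
(* A point strictly before a point of the closure is a convex combination of it with [v], with
   positive weight on [v]. *)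
have segT t w : 0 <= t -> closure K (v + w *: d) -> t < w -> K (v + t *: d).
  move=> t0 cw tw; have w0 := le_lt_trans t0 tw.
  rewrite (_ : _ + _ = (1 - t / w) *: v + (t / w) *: (v + w *: d)).
    apply: (coneDZ_closure hK) => //; last by rewrite divr_ge0 // ltW.
    by apply: (coneZ hK) => //; rewrite subr_gt0 ltr_pdivrMr// mul1r.
  by apply/rowP => i; rewrite !mxE; field; rewrite gt_eqF.
have lineK t : closure K (v + t *: d) -> 0 < t -> sup T >= t.
  move=> ct t0; rewrite leNgt; apply/negP => lt.
  pose s := (sup T + t) / 2.
  have sT : 0 <= sup T by apply: ub_le_sup => //; case: hT.
  have : T s by split; [rewrite /s; lra|apply: segT ct _; rewrite /s; lra].
  by move=> /(ub_le_sup hT.2); rewrite /s; lra.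
have tau0 : 0 < sup T.
  have : \forall t \near (0 : R), K (v + t *: d).
    have := @affine_line_continuous v d 0 K; apply.
    by rewrite scale0r addr0; apply: open_nbhs_nbhs; split => //; exact: cone_open hK.
  move=> /nbhs_normP[e /= e0 he]; have e2 : 0 < e / 2 by lra.
  apply: (lt_le_trans e2); apply: ub_le_sup; first by case: hT.
  split; first exact: ltW.
  by apply: he; rewrite /ball_ /= sub0r normrN gtr0_norm//; lra.
exists (sup T); split => //.
- move=> W /(@affine_line_continuous v d (sup T)) /nbhs_normP[e /= e0 he].
  have [t [t0 Kt] te] := sup_adherent e0 hT.
  exists (v + t *: d); split => //; apply: he; rewrite /ball_ /=.
  have tT : t <= sup T by apply: ub_le_sup; [case: hT|split].
  by rewrite ger0_norm; lra.
- move=> t tt /lineK h; have := h (lt_trans tau0 tt); lra.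
- move=> t t0 tt; have [|w [w0 Kw]] := sup_adherent (_ : 0 < sup T - t) hT.
    by rewrite subr_gt0.
  by rewrite subKr; apply: segT => //; exact: subset_closure.
Qed.

Lemma cone_near_nbhs v rho : K v -> 1 < rho ->
  \forall w \near v, K w /\ cone_near K v w rho.
Proof.
move=> Kv r1; pose s := Num.sqrt rho.
have s1 : 1 < s by rewrite -sqrtr1 ltr_sqrt// (lt_trans _ r1).
have s0 := lt_trans ltr01 s1.
have ss : s * s = rho by rewrite -expr2 sqr_sqrtr// ltW// (lt_trans _ r1).
have Ks : K (s *: v - v).
  by rewrite -[X in _ - X]scale1r -scalerBl; apply: (coneZ hK); rewrite ?subr_gt0.
have oK u : K u -> nbhs u K.
  by move=> ?; apply: open_nbhs_nbhs; split => //; exact: cone_open hK.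
have h1 : \forall w \near v, K w by exact: oK.
have h2 : \forall w \near v, K (s *: w + (-1) *: v).
  by apply: (@affine_map_continuous v s (-1) v K); rewrite scaleN1r; exact: oK.
have h3 : \forall w \near v, K ((-1) *: w + s *: v).
  by apply: (@affine_map_continuous v (-1) s v K); rewrite scaleN1r addrC; exact: oK.
near=> w; split; first by near: w.
exists s, s; split; rewrite ?ss//.
  by rewrite -[X in _ - X]scale1r -scaleNr; near: w.
by rewrite addrC -scaleN1r; near: w.
Unshelve. all: by end_near. Qed.

(** Since [a *: w - v] is in [K], its norm is controlled by its value under [f], and [b *: v - w] in
    [K] bounds that value by [(a * b - 1)] times the value at [v]. *)
Lemma cone_near_small v (W : set V) : K v -> nbhs v W ->
  exists2 rho : R, 1 < rho &
    forall w, cone_near K v w rho -> exists2 a : R, 0 < a & W (a *: w).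
Proof.
move=> Kv /nbhs_normP[e /= e0 he]; have [m m0 hm] := cone_norm_le hK.
have fv := cone_gt0 hK Kv.
(* Chosen so that the resulting bound on the norm of [a *: w - v] is [e / 2]. *)
pose c := e * m / lform f v / 2.
have c0 : 0 < c by rewrite !divr_gt0// mulr_gt0.
exists (1 + c); first by rewrite ltrDl.
move=> w [a [b [a0 b0 Ka Kb ab]]]; exists a => //; apply: he; rewrite /ball_ /=.
rewrite distrC; have /hm := Ka; rewrite -ler_pdivlMl// => /le_lt_trans; apply.
have : lform f (a *: w - v) <= c * lform f v.
  rewrite lformB lformZ lerBlDr (_ : _ + _ = (1 + c) * lform f v); last by ring.
  apply: le_trans (ler_wpM2r (ltW fv) ab).
  rewrite -mulrA ler_pM2l//.
  by have := cone_gt0 hK Kb; rewrite lformB lformZ subr_gt0 => /ltW.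
move=> h; rewrite ltr_pdivrMl//; apply: (le_lt_trans h).
rewrite (_ : c * _ = m * e / 2); first by rewrite ltr_pdivrMr// ltr_pMr ?mulr_gt0// ltr1n.
by rewrite /c; field; rewrite gt_eqF.
Qed.
End ConeTopology.

(** * Uniform packing *)

Section MaximalDeterminant.
Context {F : realFieldType} {m : nat}.

(** Cramer's rule for row vectors, by expanding the determinant on the right along row [i]. *)
Lemma det_mul_invmx_row (Z : 'M[F]_m) (w : 'rV[F]_m) (i : 'I_m) : Z \in unitmx ->
  \det Z * (w *m invmx Z) 0 i =
  \det (\matrix_(k, j) if k == i then w 0 j else Z k j).
Proof.
move=> uZ; rewrite /invmx uZ -scalemxAr mxE mulrA mulfV ?mul1r; last first.
  by rewrite -unitfE -unitmxE.
rewrite mxE (expand_det_row _ i); apply: eq_bigr => k _; rewrite !mxE eqxx.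
congr (_ * (_ * \det _)); apply/matrixP => a b; rewrite !mxE.
by rewrite eq_sym (negbTE (neq_lift _ _)).
Qed.

(** Take a selection with determinant of maximal absolute value. By Cramer's rule each coordinate is
    the quotient of another such determinant by the maximal one. *)
Lemma max_det_coord (I : finType) (v : I -> 'rV[F]_m) (s0 : {ffun 'I_m -> I}) :
  \det (\matrix_i v (s0 i)) != 0 ->
  exists s : {ffun 'I_m -> I}, forall j, exists2 c : 'I_m -> F,
    forall i, `|c i| <= 1 & v j = \sum_i c i *: v (s i).
Proof.
move=> d0; pose D (s : {ffun 'I_m -> I}) := `|\det (\matrix_i v (s i))|.
case: (@arg_maxP _ F {ffun 'I_m -> I} s0 xpredT D) => // s _ smax; exists s => j.
pose Z : 'M[F]_m := \matrix_i v (s i).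
have dZ : 0 < `|\det Z| by apply: lt_le_trans (smax s0 isT); rewrite /D normr_gt0.
have uZ : Z \in unitmx by rewrite unitmxE unitfE -normr_gt0.
exists (fun i => (v j *m invmx Z) 0 i) => [i|].
  rewrite -(ler_pM2l dZ) mulr1 -normrM det_mul_invmx_row//.
  pose t : {ffun 'I_m -> I} := [ffun k => if k == i then j else s k].
  rewrite (_ : (\matrix_(_, _) _) = \matrix_k v (t k)); first exact: smax.
  by apply/matrixP => a b; rewrite !mxE ffunE; case: ifP.
rewrite -[v j in LHS](mulmxKV uZ) mulmx_sum_row; apply: eq_bigr => i _.
by rewrite rowK.
Qed.

End MaximalDeterminant.

Section Packing.
Context {R : realType}.

Lemma truncn_eq_dist (x y eta : R) : 0 < eta -> 0 <= x -> 0 <= y ->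
  Num.truncn (x / eta) = Num.truncn (y / eta) -> `|x - y| < eta.
Proof.
move=> e0 x0 y0 e.
have := truncn_itv (divr_ge0 x0 (ltW e0)); have := truncn_itv (divr_ge0 y0 (ltW e0)).
rewrite e !ler_pdivlMr// !ltr_pdivrMr// -natr1 mulrDl mul1r.
by move=> /andP[? ?] /andP[? ?]; rewrite ltr_norml; apply/andP; split; lra.
Qed.

(** The interval from -1 to 1 is cut into cells of length [eta]. [N] is the number of lists of [m]
    cells, and the [N + 1] points cannot all have different lists. *)
Lemma pigeonhole_coord (m : nat) (eta : R) : 0 < eta -> exists N : nat,
  forall c : nat -> 'I_m -> R, (forall j i, (j <= N)%N -> `|c j i| <= 1) ->
  exists j k : nat, [/\ (j < k)%N, (k <= N)%N & forall i, `|c j i - c k i| < eta].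
Proof.
move=> e0; pose q := Num.truncn (2 / eta).
exists #|{ffun 'I_m -> 'I_q.+1}|; set N := #|_|; move=> c c1.
pose code (j : 'I_N.+1) : {ffun 'I_m -> 'I_q.+1} :=
  [ffun i => inord (Num.truncn ((c j i + 1) / eta))].
have cpos (j : 'I_N.+1) i : 0 <= c j i + 1 <= 2.
  by have := c1 j i (ltn_ord j); rewrite ler_norml => /andP[? ?]; apply/andP; split; lra.
have /injectivePn[j [k jk ejk]] : ~~ injectiveb code.
  by apply/negP => /injectiveP/leq_card; rewrite card_ord ltnn.
have close i : `|c j i - c k i| < eta.
  rewrite (_ : _ - _ = (c j i + 1) - (c k i + 1)); last by ring.
  have /andP[? ?] := cpos j i; have /andP[? ?] := cpos k i.
  apply: truncn_eq_dist => //.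
  have := congr1 (fun h : {ffun 'I_m -> 'I_q.+1} => h i) ejk; rewrite !ffunE.
  move=> /(congr1 val) /=; rewrite !inordK// ltnS; apply: le_truncn.
    by rewrite ler_pM2r ?invr_gt0.
  by rewrite ler_pM2r ?invr_gt0.
have [jlk|klj|e] := ltngtP j k.
- by exists j, k; split => //; rewrite -ltnS.
- by exists k, j; split => //; [rewrite -ltnS|move=> i; rewrite distrC].
- by move: jk; rewrite (ord_inj e) eqxx.
Qed.

Lemma cone_sum (n m : nat) (K : set 'rV[R]_n.+1) f (F : 'I_m.+1 -> 'rV[R]_n.+1) :
  proper_cone K f -> (forall i, K (F i)) -> K (\sum_i F i).
Proof.
move=> hK; elim: m F => [|m IH] F KF; first by rewrite big_ord1.
by rewrite big_ord_recl; apply: (coneD hK) => //; apply: IH => i; exact: KF.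
Qed.

(* The symmetric order interval [-rho b, rho b] is the unit ball of a norm; a
   basis of maximal determinant among the given points bounds all their
   coordinates by 1, uniformly in the cone. *)
Lemma cone_packing (n : nat) (D delta : R) : 0 < delta -> exists N : nat,
  forall (K : set 'rV[R]_n.+1) f (b : 'rV[R]_n.+1) (x : nat -> 'rV[R]_n.+1),
  proper_cone K f -> K b ->
  (forall j, (j <= N)%N -> cone_near K b (x j) (expR D)) ->
  exists i j : nat, [/\ (i < j)%N, (j <= N)%N & cone_near K (x i) (x j) (expR delta)].
Proof.
move=> delta0; set rho := expR D; have rho0 : 0 < rho by exact: expR_gt0.
(* Below, [n + 1] errors of size [eta * rho] must add up to [delta / 2]. *)
pose eta := delta / 2 / n.+1%:R / rho.
have n0 : (0 : R) < n.+1%:R by rewrite ltr0n.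
have eta0 : 0 < eta by rewrite !divr_gt0.
have etaE : n.+1%:R * (eta * rho) = delta / 2.
  by rewrite /eta divfK ?gt_eqF// mulrC divfK// gt_eqF.
have [N hN] := pigeonhole_coord n.+1 eta0; exists N => K f b x hK Kb hx.
(* In the order defined by [K], each [x j] is rescaled to lie between [b] and [rho *: b]. *)
have /choice[a ha] (j : nat) : exists a : R, (j <= N)%N ->
    [/\ 0 < a, K (a *: x j - b) & K (rho *: b - a *: x j)].
  have [jN|] := leqP j N; last by exists 0.
  have [a [c [a0 c0 Ka Kc ac]]] := hx _ jN; exists a => _; split => //.
  rewrite (_ : _ - _ = a *: (c *: b - x j) + (rho - a * c) *: b).
    by apply: (coneDZ hK); rewrite ?subr_ge0//; exact: (coneZ hK).
  by apply/rowP => i; rewrite !mxE; ring.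
pose w j := a j *: x j.
pose U u := K (rho *: b + u) /\ K (rho *: b - u).
have Krb : K (rho *: b) by exact: (coneZ hK).
have Uw j : (j <= N)%N -> U (w j).
  move=> /ha[a0 Ka Kb']; split => //.
  rewrite -[w j](subrK b) addrC; apply: (coneD hK) => //; exact: (coneD hK).
(* The points [w j] need not span. Small multiples of the standard basis, which still lie in the
   unit ball [U], are adjoined to guarantee a nonzero determinant. *)
have [e e0 Ue] : exists2 e : R, 0 < e & forall i : 'I_n.+1, U (e *: delta_mx 0 i).
  have : \forall t \near (0 : R), forall i : 'I_n.+1, K (rho *: b + t *: delta_mx 0 i).
    apply: (@filter_forall R 'I_n.+1 (fun i t => K (rho *: b + t *: delta_mx 0 i))
      (nbhs (0 : R)) _) => i.
    apply: (@affine_line_continuous R n (rho *: b) (delta_mx 0 i) 0 K).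
    by rewrite scale0r addr0; apply: open_nbhs_nbhs; split => //; exact: cone_open hK.
  move=> /nbhs_normP[r /= r0 hr]; exists (r / 2); first by lra.
  move=> i; split; first by apply: hr; rewrite /ball_ /= sub0r normrN gtr0_norm; lra.
  rewrite -scaleNr; apply: hr; rewrite /ball_ /= sub0r opprK gtr0_norm; lra.
pose F (u : 'I_N.+1 + 'I_n.+1) : 'rV[R]_n.+1 :=
  match u with inl j => w j | inr i => e *: delta_mx 0 i end.
have UF u : U (F u) by case: u => [j|i] /=; [apply: Uw; rewrite -ltnS|exact: Ue].
have [|s hs] := @max_det_coord R n.+1 _ F [ffun i => inr i].
  rewrite (_ : \matrix_i _ = e%:M).
    by rewrite det_scalar expf_neq0// gt_eqF.
  apply/matrixP => i j; rewrite !mxE ffunE /= !mxE eqxx /= eq_sym.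
  by case: eqP => _; rewrite ?mulr1 ?mulr0.
have /choice[c hc] (j : nat) : exists c : 'I_n.+1 -> R, (j <= N)%N ->
    (forall i, `|c i| <= 1) /\ w j = \sum_i c i *: F (s i).
  have [jN|] := leqP j N; last by exists (fun=> 0).
  by have [c c1 cE] := hs (inl (Ordinal (jN : (j < N.+1)%N))); exists c.
have [j i jN|j [k [jk kN cl]]] := hN c; first exact: (hc _ jN).1.
have jN : (j <= N)%N by exact: leq_trans (ltnW jk) kN.
exists j, k; split => //.
(* Each of the [n + 1] terms of [w p - w q] has a coefficient below [eta] and a vector in [U], so it
   is dominated by [(eta * rho) *: b]. *)
have diff p q : (p <= N)%N -> (q <= N)%N -> (forall i, `|c p i - c q i| < eta) ->
    K ((delta / 2) *: b + (w p - w q)).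
  move=> pN qN pq; rewrite (hc p pN).2 (hc q qN).2 -sumrB.
  rewrite (_ : _ *: b = \sum_(i < n.+1) (eta * rho) *: b); last first.
    by rewrite sumr_const card_ord -etaE -scalerA scaler_nat.
  rewrite -big_split; apply: (cone_sum hK) => i /=.
  rewrite -scalerBl; have := pq i; set d := _ - _ => dlt.
  have [Up Um] := UF (s i).
  have [d0|d0] := leP 0 d.
    rewrite (_ : _ + _ = (eta - d) *: (rho *: b) + d *: (rho *: b + F (s i))).
      apply: (coneDZ hK) => //; apply: (coneZ hK) => //.
      by rewrite subr_gt0 -(ger0_norm d0).
    by apply/rowP => l; rewrite !mxE; ring.
  rewrite (_ : _ + _ = (eta + d) *: (rho *: b) + (- d) *: (rho *: b - F (s i))).
    apply: (coneDZ hK) => //; last by lra.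
    by apply: (coneZ hK) => //; rewrite ltr0_norm// in dlt; lra.
  by apply/rowP => l; rewrite !mxE; ring.
have [[aj Kj _] [ak Kk _]] := (ha j jN, ha k kN).
(* As [w p] lies above [b], it may replace [b] in the error term. *)
have half p q : K (w p - b) -> K ((delta / 2) *: b + (w p - w q)) ->
    K ((1 + delta / 2) *: w p - w q).
  move=> Kp Kpq; rewrite (_ : _ - _ =
    ((delta / 2) *: b + (w p - w q)) + (delta / 2) *: (w p - b)).
    by apply: (coneDZ hK) => //; rewrite ltW// divr_gt0.
  by apply/rowP => l; rewrite !mxE; ring.
have h1 : 0 < 1 + delta / 2 by lra.
have : cone_near K (w j) (w k) (expR delta).
  exists (1 + delta / 2), (1 + delta / 2); split => //.
  - by apply: half => //; apply: diff => // i; rewrite distrC.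
  - by apply: half => //; exact: diff.
  - rewrite [X in expR X](_ : delta = delta / 2 + delta / 2); last by lra.
    by rewrite expRD ler_pM ?(ltW h1)// expR_ge1Dx.
move=> /(cone_nearZ hK (_ : 0 < (a j)^-1) (_ : 0 < (a k)^-1)).
rewrite !invr_gt0 => /(_ aj ak).
by rewrite !scalerA !mulVf ?gt_eqF// !scale1r.
Qed.

End Packing.

(** * The cone over a properly convex set *)

Section EuclideanNorm.
Context {R : realType} {n : nat}.
Implicit Type v : 'rV[R]_n.

Lemma enormZ (a : R) v : enorm (a *: v) = `|a| * enorm v.
Proof.
rewrite /enorm -sqrtr_sqr -sqrtrM ?sqr_ge0//; congr Num.sqrt.
by rewrite mulr_sumr; apply: eq_bigr => i _; rewrite mxE exprMn.
Qed.

Lemma enormN v : enorm (- v) = enorm v.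
Proof. by rewrite -scaleN1r enormZ normrN1 mul1r. Qed.

Lemma enorm_gt0 v : v != 0 -> 0 < enorm v.
Proof.
move=> v0; rewrite sqrtr_gt0 lt_neqAle sumr_ge0 ?andbT; last by move=> i _; exact: sqr_ge0.
apply: contraNN v0; rewrite eq_sym psumr_eq0; last by move=> i _; exact: sqr_ge0.
move=> /allP h; apply/eqP/rowP => i; rewrite mxE; apply/eqP.
by rewrite -sqrf_eq0; exact: h (mem_index_enum i).
Qed.
End EuclideanNorm.

Section ConeOver.
Context {R : realType} {n : nat} (O : set (RP R n)).
Implicit Types (f : 'cV[R]_n.+1) (v w : 'rV[R]_n.+1).

(** When [O] lies in the patch of [f], its preimage consists of two opposite halves, and the sign of
    [f] selects one. *)
Definition cone_over f : set 'rV[R]_n.+1 := [set v | 0 < lform f v /\ O (cl v)].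

Lemma lform_neq0 f v : lform f v != 0 -> v != 0.
Proof. by apply: contraNneq => ->; rewrite lform0. Qed.

Lemma affine_patchE f (p : RP R n) : affine_patch f p <-> lform f (repr_vec p) != 0.
Proof.
rewrite /affine_patch /=; split.
  by apply: contraNneq => h; apply/eqP/matrixP => i j; rewrite !ord1 [RHS]mxE.
by apply: contraNneq => h; rewrite /lform h mxE.
Qed.

Lemma affine_patch_cl f v : v != 0 -> affine_patch f (cl v) <-> lform f v != 0.
Proof.
move=> v0; rewrite affine_patchE; have [a a0 ->] := repr_cl v0.
by rewrite lformZ mulf_eq0 negb_or a0.
Qed.

Lemma affine_coordE f p : affine_coord f p = (lform f (repr_vec p))^-1 *: repr_vec p.
Proof. by []. Qed.

Lemma affine_coord_cl f v : lform f v != 0 ->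
  affine_coord f (cl v) = (lform f v)^-1 *: v.
Proof.
move=> fv; rewrite affine_coordE; have [a a0 ->] := repr_cl (lform_neq0 fv).
by rewrite lformZ invfM scalerA mulrAC mulVf// mul1r.
Qed.

Lemma affine_coord_form1 f v : lform f v = 1 -> affine_coord f (cl v) = v.
Proof. by move=> f1; rewrite affine_coord_cl f1 ?oner_neq0// invr1 scale1r. Qed.

Lemma lform_affine_coord f p : affine_patch f p -> lform f (affine_coord f p) = 1.
Proof. by move=> /affine_patchE fp; rewrite affine_coordE lformZ mulVf. Qed.

Lemma cl_affine_coord f p : affine_patch f p -> cl (affine_coord f p) = p.
Proof.
by move=> /affine_patchE fp; rewrite affine_coordE clZ ?invr_eq0// cl_repr.
Qed.

Lemma affine_coordN f p : affine_coord (- f) p = - affine_coord f p.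
Proof. by rewrite !affine_coordE lformN invrN scaleNr. Qed.

Lemma affine_patchN f : affine_patch (- f) = affine_patch f :> set (RP R n).
Proof.
by apply/seteqP; split => p /affine_patchE h; apply/affine_patchE;
  move: h; rewrite lformN oppr_eq0.
Qed.

(** A product of two functions homogeneous of degree 1 has a sign that does not depend on the
    representative. *)
Lemma quadratic_pos_open (g h : 'rV[R]_n.+1 -> R) :
  continuous g -> continuous h ->
  (forall a v, g (a *: v) = a * g v) -> (forall a v, h (a *: v) = a * h v) ->
  open [set p : RP R n | 0 < g (repr_vec p) * h (repr_vec p)].
Proof.
move=> cg ch gZ hZ.
rewrite (_ : [set p | _] = [set p : RP R n | exists2 a : R, a != 0 &
    [set v | 0 < g v * h v] (a *: repr_vec p)]).
  apply: saturation_open.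
  rewrite -[X in open X]/((fun v => g v * h v) @^-1` [set x | 0 < x]).
  by apply: open_comp => [v _|]; [exact: (cvgM (cg v) (ch v))|exact: open_gt].
apply/seteqP; split => p /=.
  by exists 1; rewrite ?oner_neq0// scale1r.
move=> [a a0]; rewrite gZ hZ mulrACA -expr2.
by rewrite pmulr_rgt0// exprn_even_gt0.
Qed.

Lemma cone_overZ f (a : R) v : 0 < a -> cone_over f v -> cone_over f (a *: v).
Proof. by move=> a0 [fv Ov]; split; rewrite ?lformZ ?mulr_gt0// clZ// gt_eqF. Qed.

(** Suppose that the class of [z = v + w] is not in [O]. On the line through [v] and [w], this point
    and the zero of [f] separate the classes of [v] and [w], and [O] avoids both, against
    connectedness. *)
Lemma cone_overD f v w :
  closure O `<=` affine_patch f ->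
  (forall L, projective_line L -> connected (L `&` O)) ->
  cone_over f v -> cone_over f w -> cone_over f (v + w).
Proof.
move=> Of cO Kv Kw; have [fv Ov] := Kv; have [fw Ow] := Kw.
have v0 := lform_neq0 (lt0r_neq0 fv); have w0 := lform_neq0 (lt0r_neq0 fw).
set z := v + w.
have fz : lform f z = lform f v + lform f w by rewrite lformD.
have fz0 : 0 < lform f z by rewrite fz addr_gt0.
have [wv|wv] := boolP (w \in <[v]>)%VS.
  have [a wE] := vlineP _ _ wv; rewrite /z wE -[X in X + _]scale1r -scalerDl.
  apply: cone_overZ => //; move: fw; rewrite wE lformZ pmulr_lgt0//; lra.
split => //; apply: contrapT => nOz.
have [i hi] : exists i, lform f w * v 0 i - lform f v * w 0 i != 0.
  apply: contrapT => /forallNP h; move/negP: wv; apply; apply/vlineP.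
  exists (lform f w / lform f v); apply/rowP => i; rewrite mxE.
  have /negP/negPn/eqP := h i; move/subr0_eq => e.
  by rewrite mulrAC e mulrC mulKf// gt_eqF.
set k := _ - _ in hi.
(* A linear form whose zeros in the span of [v] and [w] are the multiples of [z]; the factor [k]
   makes it positive at [v] and negative at [w]. *)
pose g (u : 'rV[R]_n.+1) := k * (lform f z * u 0 i - z 0 i * lform f u).
have gv : g v = k * k by rewrite /g fz /z !mxE /k; ring.
have gw : g w = - (k * k) by rewrite /g fz /z !mxE /k; ring.
have kk : 0 < k * k by rewrite -expr2 exprn_even_gt0.
have gZ a u : g (a *: u) = a * g u by rewrite /g lformZ !mxE; ring.
have cg : continuous g.
  move=> u.
  have ci : (u' : 'rV[R]_n.+1) 0 i @[u' --> u] --> u 0 i by exact: coord_continuous.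
  have cf : lform f u' @[u' --> u] --> lform f u by exact: lform_continuous.
  exact: (cvgM (cvg_cst k) (cvgB (cvgM (cvg_cst (lform f z)) ci) (cvgM (cvg_cst (z 0 i)) cf))).
pose S1 := [set p : RP R n | 0 < g (repr_vec p) * lform f (repr_vec p)].
pose S2 := [set p : RP R n | 0 < - g (repr_vec p) * lform f (repr_vec p)].
have oS1 : open S1.
  apply: quadratic_pos_open => //; first exact: lform_continuous.
  by move=> *; exact: lformZ.
have oS2 : open S2.
  apply: (@quadratic_pos_open (fun u => - g u)).
  - by move=> u; exact: (cvgN (cg u)).
  - exact: lform_continuous.
  - by move=> a u; rewrite gZ mulrN.
  - by move=> *; exact: lformZ.
pose L := [set p : RP R n | repr_vec p \in <<[:: v; w]>>%VS].
have lineL : projective_line L.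
  exists <<[:: v; w]>>%VS => //; apply/eqP.
  rewrite -[_ == _]/(free [:: v; w]) (perm_free (_ : perm_eq _ [:: w; v])).
    by rewrite free_cons seq1_free v0 span_seq1 wv.
  by rewrite -[X in perm_eq _ X]/(rev [:: v; w]) perm_sym perm_rev.
have Lcl u : u \in [:: v; w] -> L (cl u).
  move=> uvw; have u0 : u != 0 by move: uvw; rewrite !inE => /orP[/eqP->|/eqP->].
  by rewrite /L /=; have [a _ ->] := repr_cl u0; rewrite memvZ// memv_span.
have Sv : S1 (cl v).
  rewrite /S1 /=; have [a a0 ->] := repr_cl v0.
  by rewrite gZ lformZ mulrACA -expr2 pmulr_rgt0 ?exprn_even_gt0// gv mulr_gt0.
have Sw : ~ S1 (cl w).
  rewrite /S1 /=; have [a a0 ->] := repr_cl w0.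
  rewrite gZ lformZ mulrACA -expr2 pmulr_rgt0 ?exprn_even_gt0// gw mulNr oppr_gt0.
  by apply/negP; rewrite -leNgt ltW// mulr_gt0.
have cover : (L `&` O) `&` S1 = (L `&` O) `&` ~` S2.
  apply/seteqP; split => p [[Lp Op]]; rewrite /S1 /S2 /= mulNr oppr_gt0 => h.
    by split => //; apply/negP; rewrite -leNgt ltW.
  split => //; rewrite lt_neqAle leNgt; apply/andP; split; last exact/negP.
  rewrite eq_sym mulf_eq0 negb_or; apply/andP; split; last first.
    by apply/affine_patchE/Of; exact: subset_closure.
  apply/eqP => g0; apply: nOz.
  move: Lp; rewrite /L /= span_cons span_seq1 => /memv_addP[_ /vlineP[a ->] [_ /vlineP[b ->]]].
  move=> e; move: g0; rewrite e.
  have -> : g (a *: v + b *: w) = (a - b) * (k * k).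
    by rewrite /g fz lformD !lformZ /z !mxE /k; ring.
  move=> /eqP; rewrite mulf_eq0 (gt_eqF kk) orbF subr_eq0 => /eqP ab.
  move: Op; rewrite -[p]cl_repr e -ab -scalerDr clZ//.
  by apply: contraTneq (repr_vec_neq0 p) => a0; rewrite e -ab a0 !scale0r addr0 eqxx.
(* By [cover] this part of the connected set is both relatively open and relatively closed, and it
   contains the class of [v]. *)
have LOS : L `&` O `&` S1 = L `&` O.
  apply: (cO L lineL).
  - by exists (cl v); split => //; split => //; apply: Lcl; rewrite !inE eqxx.
  - by exists S1.
  - by exists (~` S2) => //; exact: open_closedC.
apply: Sw; have : (L `&` O) (cl w).
  by split => //; apply: Lcl; rewrite !inE eqxx orbT.
by rewrite -LOS => -[].
Qed.

Lemma closure_cone_over_cl f v : closure (cone_over f) v -> v != 0 -> closure O (cl v).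
Proof.
move=> cv v0; apply/(closure_cl _ v0); apply: closureS cv => w [fw Ow].
by split => //; exact: lform_neq0 (lt0r_neq0 fw).
Qed.

Lemma mem_closure_cone_over f v : 0 < lform f v -> closure O (cl v) ->
  closure (cone_over f) v.
Proof.
move=> fv; rewrite (closure_cl _ (lform_neq0 (lt0r_neq0 fv))).
move=> cv W Wv; have : nbhs v [set w | 0 < lform f w].
  exact: (cvgr_gt (lform f v) (@lform_continuous _ _ f v) _ fv).
by move=> /(filterI Wv)/cv[w [[w0 Ow] [Ww fw]]]; exists w.
Qed.

Lemma cone_over_proper f : open O -> closure O `<=` affine_patch f ->
  (forall L, projective_line L -> connected (L `&` O)) ->
  proper_cone (cone_over f) f.
Proof.
move=> oO Of cO; split.
- rewrite (_ : cone_over f = lform f @^-1` [set x | 0 < x] `&`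
      [set v | v != 0 /\ O (cl v)]).
    apply: openI; last exact: cl_open.
    by apply: open_comp => [v _|]; [exact: lform_continuous|exact: open_gt].
  apply/seteqP; split => v [fv]; last by case.
  by move=> Ov; split => //; split => //; exact: lform_neq0 (lt0r_neq0 fv).
- by move=> v w; exact: cone_overD.
- by move=> a v; exact: cone_overZ.
- by move=> v [].
- move=> v cv v0; rewrite lt_neqAle eq_sym; apply/andP; split.
    by apply/(affine_patch_cl _ v0)/Of; exact: closure_cone_over_cl cv v0.
  have cl0 : closed (lform f @^-1` [set x | 0 <= x]).
    by apply: preimage_closed => [w _|]; [exact: lform_continuous|exact: closed_ge].
  by apply: cl0; apply: closureS cv => w [/ltW].
Qed.

End ConeOver.

(** * Birkhoff's formula for the Hilbert metric *)

Section HilbertMetric.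
Context {R : realType} {n : nat} (O : set (RP R n)).
Hypotheses (oO : open O) (cO : forall L, projective_line L -> connected (L `&` O)).
Context (f : 'cV[R]_n.+1) (Of : closure O `<=` affine_patch f).
Local Notation K := (cone_over O f).
Let hK : proper_cone K f := cone_over_proper oO Of cO.

Lemma cone_over_sign (g : 'cV[R]_n.+1) : closure O `<=` affine_patch g ->
  (forall v, K v -> 0 < lform g v) \/ (forall v, K v -> 0 < lform (- g) v).
Proof.
move=> Og.
apply: (cone_form_sign hK) => v Kv.
apply/(affine_patch_cl _ (cone_neq0 hK Kv))/Og.
by apply: subset_closure; case: Kv.
Qed.

(** This makes the Hilbert distance independent of the patch: [hilbert_spec] may use any form [g],
    and up to sign it gives the same cone. *)
Lemma cone_over_eq (g : 'cV[R]_n.+1) : closure O `<=` affine_patch g ->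
  (forall v, K v -> 0 < lform g v) -> cone_over O g = K.
Proof.
move=> Og gK; apply/seteqP; split => v; last first.
  by move=> Kv; split; [exact: gK|case: Kv].
move=> [gv Ov]; split => //; rewrite ltNge le_eqVlt.
have v0 := lform_neq0 (lt0r_neq0 gv).
have /(affine_patch_cl _ v0) fv : affine_patch f (cl v).
  by apply: Of; exact: subset_closure.
rewrite (negbTE fv) /=; apply/negP => fv0.
have /gK : K (-1 *: v).
  by split; rewrite ?clZ ?oppr_eq0 ?oner_neq0// lformZ mulN1r oppr_gt0.
by rewrite lformZ mulN1r oppr_gt0 ltNge ltW.
Qed.

Lemma cone_near_self v rho : K v -> cone_near K v v rho <-> 1 < rho.
Proof.
move=> Kv; split; last exact: (cone_near_refl hK).
have fv := cone_gt0 hK Kv.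
move=> [a [b [a0 b0 /(cone_gt0 hK) Ka /(cone_gt0 hK) Kb]]]; apply: lt_le_trans.
move: Ka Kb; rewrite !lformB !lformZ !subr_gt0 !ltr_pMl// => a1 b1.
by rewrite -[1]mulr1; apply: ltr_pM.
Qed.

Lemma cone_near_iffZ v w rho (c d : R) : 0 < c -> 0 < d ->
  cone_near K (c *: v) (d *: w) rho <-> cone_near K v w rho.
Proof.
move=> c0 d0; split; last exact: (cone_nearZ hK).
move=> /(cone_nearZ hK (_ : 0 < c^-1) (_ : 0 < d^-1)).
rewrite !invr_gt0 => /(_ c0 d0).
by rewrite !scalerA !mulVf ?scale1r// gt_eqF.
Qed.

Lemma boundary_not_cone v : boundary (closure O) (cl v) -> ~ K v.
Proof.
move=> [_ nv] [_ Ov]; apply: nv; exists O => //.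
by split => //; exact: subset_closure.
Qed.

Lemma cross_ratio_segment (x y : 'rV[R]_n.+1) (s t : R) : x != y ->
  0 < s -> s < t -> t < 1 ->
  let a := (1 - s) *: x + s *: y in let b := (1 - t) *: x + t *: y in
  enorm (b - x) * enorm (a - y) / (enorm (b - y) * enorm (a - x)) =
  t * (1 - s) / (s * (1 - t)).
Proof.
move=> xy s0 st t1 a b.
have e0 : enorm (y - x) != 0 by rewrite gt_eqF// enorm_gt0// subr_eq0 eq_sym.
have -> : b - x = t *: (y - x) by apply/rowP => i; rewrite !mxE; ring.
have -> : a - x = s *: (y - x) by apply/rowP => i; rewrite !mxE; ring.
have -> : b - y = - ((1 - t) *: (y - x)) by apply/rowP => i; rewrite !mxE; ring.
have -> : a - y = - ((1 - s) *: (y - x)) by apply/rowP => i; rewrite !mxE; ring.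
rewrite !enormN !enormZ !gtr0_norm//; try lra.
by field; rewrite e0 !gt_eqF//; lra.
Qed.

(** Normalised to the patch used by the specification, the two points lie on a segment between
    boundary points, and [cone_near_seg] applies. The equivalence for all [q] determines [r], so the
    choice made in [hilbert] is harmless. *)
Lemma hilbert_specP v w r : K v -> K w -> hilbert_spec O (cl v) (cl w) r ->
  forall q, r < q <-> cone_near K v w (expR q).
Proof.
move=> Kv Kw [[e ->] q|[ne [g [x [y [s [t /= [Og bxy [s0 st t1] [ea eb] rE]]]]]]] q].
  have [a a0 wE] := cl_inj (cone_neq0 hK Kv) (cone_neq0 hK Kw) e.
  have a1 : 0 < a.
    by have := cone_gt0 hK Kw; rewrite wE lformZ pmulr_lgt0// (cone_gt0 hK).
  rewrite -[v in cone_near _ v]scale1r wE cone_near_iffZ//.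
  by rewrite cone_near_self// -expR0 ltr_expR.
(* Replacing [g] by its opposite negates all affine coordinates, which preserves the convex
   combinations and the norms. *)
wlog gK : g Og ea eb rE / forall u, K u -> 0 < lform g u.
  move=> hw; have [gK|gK] := cone_over_sign Og; first exact: (hw g).
  apply: (hw (- g)) => //.
  - by rewrite affine_patchN.
  - by rewrite !affine_coordN ea; rewrite !scalerN opprD.
  - by rewrite !affine_coordN eb; rewrite !scalerN opprD.
  - by rewrite !affine_coordN -!opprD !enormN.
have KE := cone_over_eq Og gK.
have hKg : proper_cone K g by rewrite -KE; exact: cone_over_proper.
have cc : closure (closure O) = closure O by exact/esym/closure_id/closed_closure.
have Px p : boundary (closure O) p -> affine_patch g p.
  by move=> [cp _]; apply: Og; rewrite -cc.
have [bx by_] := bxy; have [px py] := (Px _ bx, Px _ by_).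
set X := affine_coord g x in ea eb rE; set Y := affine_coord g y in ea eb rE.
have gX : lform g X = 1 by exact: lform_affine_coord.
have gY : lform g Y = 1 by exact: lform_affine_coord.
have clX : cl X = x by exact: cl_affine_coord.
have clY : cl Y = y by exact: cl_affine_coord.
have cX : closure K X.
  rewrite -KE; apply: mem_closure_cone_over; first by rewrite gX.
  by rewrite clX -cc; case: bx.
have cY : closure K Y.
  rewrite -KE; apply: mem_closure_cone_over; first by rewrite gY.
  by rewrite clY -cc; case: by_.
have nX : ~ K X by apply: boundary_not_cone; rewrite clX.
have nY : ~ K Y by apply: boundary_not_cone; rewrite clY.
have [gv gw] := (gK v Kv, gK w Kw).
rewrite affine_coord_cl ?gt_eqF// in ea.
rewrite affine_coord_cl ?gt_eqF// in eb.
have KsXY : K ((1 - s) *: X + s *: Y).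
  by rewrite -ea; apply: (coneZ hK) => //; rewrite invr_gt0.
have XY : X != Y.
  by apply/eqP => XY; apply: nX; move: KsXY; rewrite -XY -scalerDl subrK scale1r.
have hseg := cone_near_seg hKg (expR q) cX cY nX nY gX gY s0 st t1 KsXY.
rewrite -(@cone_near_iffZ v w _ (lform g v)^-1 (lform g w)^-1) ?invr_gt0//.
rewrite ea eb hseg rE affine_coord_cl ?gt_eqF// affine_coord_cl ?gt_eqF// ea eb.
rewrite cross_ratio_segment// -ltr_expR lnK// posrE divr_gt0// mulr_gt0//; lra.
Qed.

(** If the exit point were interior, points slightly later on the line would still be in the
    closure. *)
Lemma boundary_exit v d tau : lform f v = 1 -> lform f d = 0 ->
  closure K (v + tau *: d) -> (forall t, tau < t -> ~ closure K (v + t *: d)) ->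
  boundary (closure O) (cl (v + tau *: d)).
Proof.
move=> fv fd ct nt.
have f1 t : lform f (v + t *: d) = 1 by rewrite lformD lformZ fd mulr0 addr0.
have u0 t : v + t *: d != 0 by apply: (@lform_neq0 _ _ f); rewrite f1 oner_neq0.
split.
  by apply: subset_closure; exact: closure_cone_over_cl ct (u0 _).
rewrite /interior => /(nbhs_cl (u0 _)) /(@affine_line_continuous R n v d tau).
move=> /nbhs_normP[e /= e0 he].
have [_ ce] : v + (tau + e / 2) *: d != 0 /\ closure O (cl (v + (tau + e / 2) *: d)).
  by apply: he; rewrite /ball_ /= opprD addNKr normrN gtr0_norm; lra.
apply: (nt (tau + e / 2)); first lra.
by apply: mem_closure_cone_over => //; rewrite f1.
Qed.

(** The segment is prolonged beyond both ends until it leaves the cone, by [cone_exit]. *)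
Lemma hilbert_spec_exists v w : K v -> K w -> exists r, hilbert_spec O (cl v) (cl w) r.
Proof.
move=> Kv Kw; have [vw|vw] := pselect (cl v = cl w); first by exists 0; left.
have [fv0 fw0] := (cone_gt0 hK Kv, cone_gt0 hK Kw).
pose a := (lform f v)^-1 *: v; pose b := (lform f w)^-1 *: w.
have fa : lform f a = 1 by rewrite lformZ mulVf// gt_eqF.
have fb : lform f b = 1 by rewrite lformZ mulVf// gt_eqF.
have ca : cl a = cl v by rewrite clZ// invr_eq0 gt_eqF.
have cb : cl b = cl w by rewrite clZ// invr_eq0 gt_eqF.
have Ka : K a by apply: (coneZ hK); rewrite ?invr_gt0.
have Kb : K b by apply: (coneZ hK); rewrite ?invr_gt0.
have d0 : b - a != 0 by apply/eqP => /subr0_eq h; apply: vw; rewrite -ca -cb h.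
have fd : lform f (b - a) = 0 by rewrite lformB fa fb subrr.
have fd' : lform f (a - b) = 0 by rewrite lformB fa fb subrr.
have [p [p0 cp np _]] := cone_exit hK Kb d0 fd.
have [q [q0 cq nq _]] : exists tau : R, [/\ 0 < tau, closure K (a + tau *: (a - b)),
    forall t, tau < t -> ~ closure K (a + t *: (a - b)) & True].
  have [|q [? ? ? _]] := cone_exit hK Ka _ fd'; last by exists q.
  by rewrite -opprB oppr_eq0.
(* With [a] at 0 and [b] at 1 on the line, the exit points are at [- q] and [1 + p]. Hence the
   parameters [q / L] and [(1 + q) / L] below. *)
pose L := 1 + p + q; have L0 : 0 < L by rewrite /L; lra.
pose X := a + q *: (a - b); pose Y := b + p *: (b - a).
have fX : lform f X = 1 by rewrite lformD [X in _ + X]lformZ fd' mulr0 addr0 fa.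
have fY : lform f Y = 1 by rewrite lformD [X in _ + X]lformZ fd mulr0 addr0 fb.
eexists; right; split => //.
exists f, (cl X), (cl Y), (q / L), ((1 + q) / L).
rewrite /= !(affine_coord_form1 fX) !(affine_coord_form1 fY).
have -> : affine_coord f (cl v) = a by rewrite -ca affine_coord_form1.
have -> : affine_coord f (cl w) = b by rewrite -cb affine_coord_form1.
split => //=.
- by split; exact: boundary_exit.
- split; first by rewrite divr_gt0.
    by rewrite ltr_pM2r ?invr_gt0//; lra.
  by rewrite ltr_pdivrMr// mul1r /L; lra.
- split; apply/rowP => i; rewrite !mxE /L; field;
  rewrite -/L (gt_eqF L0) (gt_eqF fv0) (gt_eqF fw0)//.
Qed.

Lemma hilbert_ltP v w r : K v -> K w ->
  hilbert O (cl v) (cl w) < r <-> cone_near K v w (expR r).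
Proof.
move=> Kv Kw; apply: hilbert_specP => //; rewrite /hilbert.
exact: (xgetPex 0 (hilbert_spec_exists Kv Kw)).
Qed.

End HilbertMetric.

(** * Deck transformations *)

Section Transformations.
Context {R : realType} {n : nat}.

Lemma induces_cl (A : 'M[R]_n.+1) (g : RP R n -> RP R n) (v : 'rV[R]_n.+1) :
  induces A g -> v != 0 -> v *m A != 0 /\ cl (v *m A) = g (cl v).
Proof.
move=> [_ gA] v0; have [b b0 eb] := repr_cl v0; have [a a0 ea] := gA (cl v).
rewrite eb -scalemxAl scalerA in ea; have ab0 : a * b != 0 by rewrite mulf_neq0.
split; last by rewrite -[RHS]cl_repr ea clZ.
by apply: contraNneq (repr_vec_neq0 (g (cl v))) => h; rewrite ea h scaler0.
Qed.

(** Compare the eigenvalues at [v], [v + t *: e] and [v + (2 * t) *: e]. Eliminating [e *m A] gives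
    a linear relation between [e] and [v]: either the eigenvalues agree or [e] is a multiple of
    [v]. *)
Lemma locally_eigen_scalar (A : 'M[R]_n.+1) (v : 'rV[R]_n.+1) : v != 0 ->
  (\forall w \near v, exists c : R, w *m A = c *: w) ->
  exists c : R, forall w : 'rV[R]_n.+1, w *m A = c *: w.
Proof.
move=> v0 hv; have [c vc] := nbhs_singleton hv; exists c => e.
have := @affine_line_continuous R n v e 0 _ _; rewrite scale0r addr0 => /(_ _ hv).
move=> /nbhs_normP[r /= r0 hr].
have [t t0 tr] : exists2 t : R, 0 < t & 2 * t < r by exists (r / 4); lra.
have [|c1 h1] := hr t; first by rewrite /ball_ /= sub0r normrN gtr0_norm; lra.
have [|c2 h2] := hr (2 * t); first by rewrite /ball_ /= sub0r normrN gtr0_norm; lra.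
rewrite mulmxDl -scalemxAl vc in h1; rewrite mulmxDl -scalemxAl vc in h2.
have key : (2 * t * (c2 - c1)) *: e = (2 * c1 - c - c2) *: v.
  have e1 : t *: (e *m A) = c1 *: (v + t *: e) - c *: v by rewrite -h1 addrC addKr.
  have e2 : (2 * t) *: (e *m A) = c2 *: (v + (2 * t) *: e) - c *: v.
    by rewrite -h2 addrC addKr.
  move: e2; rewrite -scalerA e1 => e2.
  have : 2 *: (c1 *: (v + t *: e) - c *: v) - (c2 *: (v + (2 * t) *: e) - c *: v) = 0.
    by rewrite e2 subrr.
  move=> e3; apply/eqP; rewrite -subr_eq0 -oppr_eq0 -e3; apply/eqP/rowP => i.
  by rewrite !mxE; ring.
have [c12|c12] := eqVneq c1 c2.
  rewrite c12 subrr mulr0 scale0r in key.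
  have c2c : c = c2.
    move/esym/eqP: key; rewrite scaler_eq0 (negbTE v0) orbF => /eqP; lra.
  rewrite c12 c2c scalerDr in h1; move/addrI: h1; rewrite scalerA mulrC -scalerA c2c.
  by apply: scalerI; rewrite gt_eqF.
have k0 : 2 * t * (c2 - c1) != 0.
  by apply: mulf_neq0; [rewrite gt_eqF// mulr_gt0|rewrite subr_eq0 eq_sym].
have -> : e = ((2 * t * (c2 - c1))^-1 * (2 * c1 - c - c2)) *: v.
  by rewrite -scalerA -key scalerA mulVf// scale1r.
by rewrite -scalemxAl vc [LHS]scalerA [RHS]scalerA [c * _]mulrC.
Qed.

Lemma locally_fixed_id (A : 'M[R]_n.+1) (g : RP R n -> RP R n) (v : 'rV[R]_n.+1) :
  induces A g -> v != 0 -> (\forall w \near v, w != 0 -> g (cl w) = cl w) -> g = idfun.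
Proof.
move=> gA v0 hv.
have [|c hc] := @locally_eigen_scalar A v v0.
  apply: filterS hv => w hw; have [->|w0] := eqVneq w 0.
    by exists 0; rewrite mul0mx scaler0.
  have [wA0 e] := induces_cl gA w0; rewrite hw// in e.
  by have [a _ ->] := cl_inj w0 wA0 (esym e); exists a.
apply/funext => p; have p0 := repr_vec_neq0 p.
have [] := induces_cl gA p0; rewrite hc cl_repr => cp0 <- /=.
rewrite clZ ?cl_repr//; apply: contraNneq cp0 => ->; by rewrite scale0r.
Qed.

End Transformations.

Section Manifold.
Context {R : realType} {n : nat} (M : pcManifold R n).
Local Notation O := (pcm_domain M).
Local Notation G := (pcm_group M).
Local Notation dist := (@hilbert_dist R n M).
Implicit Types (a b : domain_points M) (g h : RP R n -> RP R n).

Lemma domain_pointP a : O (val a).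
Proof. exact: set_mem (valP a). Qed.

Lemma pcm_cone : exists f : 'cV[R]_n.+1,
  [/\ closure O `<=` affine_patch f, proper_cone (cone_over O f) f,
    forall a, exists2 v, cone_over O f v & cl v = val a &
    forall v, cone_over O f v -> exists a, val a = cl v].
Proof.
have [cO [f _ Of]] := pcm_domain_properly_convex M; exists f.
have hK := cone_over_proper (pcm_domain_open M) Of cO.
split => // [a|v [fv Ov]]; last by exists (exist (fun p => p \in O) (cl v) (mem_set Ov)).
have pa : affine_patch f (val a) by apply: Of; apply: subset_closure; exact: domain_pointP.
exists (affine_coord f (val a)); last exact: cl_affine_coord.
split; rewrite ?lform_affine_coord// cl_affine_coord//; exact: domain_pointP.
Qed.

Lemma dist_ltP f v w a b r : closure O `<=` affine_patch f ->
  cone_over O f v -> cone_over O f w -> cl v = val a -> cl w = val b ->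
  dist a b < r <-> cone_near (cone_over O f) v w (expR r).
Proof.
move=> Of Kv Kw va wb; rewrite /hilbert_dist -va -wb.
by apply: hilbert_ltP => //; [exact: pcm_domain_open|case: (pcm_domain_properly_convex M)].
Qed.

Lemma dist_refl a : dist a a = 0.
Proof.
have [f [Of hK rep _]] := pcm_cone; have [v Kv va] := rep a.
have h r : dist a a < r <-> 0 < r.
  rewrite (dist_ltP _ Of Kv Kv va va) (cone_near_self (pcm_domain_open M)) //.
    by rewrite -expR0 ltr_expR.
  by case: (pcm_domain_properly_convex M).
apply/eqP; rewrite eq_le; apply/andP; split; rewrite leNgt; apply/negP.
  by move=> /[dup] /h; rewrite ltxx.
by move=> /h; rewrite ltxx.
Qed.

Lemma dist_lt_triangle a b c r s : dist a b < r -> dist b c < s -> dist a c < r + s.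
Proof.
have [f [Of hK rep _]] := pcm_cone.
have [[[u Ku ua] [v Kv vb]] [w Kw wc]] := (rep a, rep b, rep c).
move=> /(dist_ltP _ Of Ku Kv ua vb) h1 /(dist_ltP _ Of Kv Kw vb wc) h2.
apply/(dist_ltP _ Of Ku Kw ua wc); rewrite expRD.
exact: (cone_near_trans hK h1 h2).
Qed.

Lemma dist_triangle b a c : dist a c <= dist a b + dist b c.
Proof.
apply/ler_addgt0Pr => e e0.
have := @dist_lt_triangle a b c (dist a b + e / 2) (dist b c + e / 2).
rewrite !ltrDl !divr_gt0// => /(_ isT isT); lra.
Qed.

Lemma dist_sym a b : dist a b = dist b a.
Proof.
suff H x y : dist x y <= dist y x by apply/eqP; rewrite eq_le !H.
have [f [Of hK rep _]] := pcm_cone; have [[u Ku ux] [v Kv vy]] := (rep x, rep y).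
apply/ler_addgt0Pr => e e0; apply/ltW/(dist_ltP _ Of Ku Kv ux vy).
by apply/cone_near_sym/(dist_ltP _ Of Kv Ku vy ux); rewrite ltrDl.
Qed.

Lemma dist_ge0 a b : 0 <= dist a b.
Proof. by have := dist_triangle b a a; rewrite dist_refl (dist_sym b a); lra. Qed.

Lemma small_dist_nbhs a (W : set (RP R n)) : nbhs (val a) W ->
  exists2 r : R, 0 < r & forall b, dist a b < r -> W (val b).
Proof.
have [f [Of hK rep _]] := pcm_cone; have [v Kv va] := rep a.
rewrite -va => /(nbhs_cl (cone_neq0 hK Kv)) /(cone_near_small hK Kv)[rho rho1 hrho].
exists (ln rho); first exact: ln_gt0.
move=> b; have [w Kw wb] := rep b.
move=> /(dist_ltP _ Of Kv Kw va wb); rewrite lnK ?posrE ?(lt_trans _ rho1)//.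
by move=> /hrho[c c0 [_]]; rewrite clZ ?gt_eqF// wb.
Qed.

Lemma group_domain g p : G g -> O p -> O (g p).
Proof. by move=> Gg Op; rewrite -(pcm_group_preserves Gg); exists p. Qed.

(** The default value [a] is never reached when [g] is in the group, by [group_domain]. *)
Definition act g a : domain_points M := insubd a (g (val a)).

Lemma val_act g a : G g -> val (act g a) = g (val a).
Proof.
move=> Gg; rewrite insubdK//; apply/mem_set/group_domain => //.
exact: domain_pointP.
Qed.

Lemma act_comp g h a : G g -> G h -> act (g \o h) a = act g (act h a).
Proof.
move=> Gg Gh; apply: val_inj; have [_ _ GM _] := pcm_is_group M.
by rewrite !val_act//; exact: GM.
Qed.

Lemma orbit_proj_act g a : G g -> orbit_proj (act g a) = orbit_proj a.
Proof. by move=> Gg; apply/esym/eqmodP/asboolP; exists g => //; exact: val_act. Qed.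

Lemma orbit_projP a b : orbit_proj a = orbit_proj b -> exists2 g, G g & b = act g a.
Proof.
by move=> /eqmodP/asboolP[g Gg e]; exists g => //; apply: val_inj; rewrite val_act.
Qed.

Lemma orbit_proj_surj (x : orbit_space M) : exists a, orbit_proj a = x.
Proof. by exists (repr x); rewrite /orbit_proj reprK. Qed.

(** An inducing matrix maps the cone to itself or to its opposite, since the pulled-back form
    [A *m f] has no zero on the cone; in the second case [- A] is taken. *)
Lemma group_cone_matrix f g : G g -> closure O `<=` affine_patch f ->
  proper_cone (cone_over O f) f ->
  exists A, induces A g /\ forall v, cone_over O f v -> cone_over O f (v *m A).
Proof.
move=> Gg Of hK; have [GT _ _ _] := pcm_is_group M; have [A gA] := GT g Gg.
have OA v : cone_over O f v -> O (cl (v *m A)).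
  move=> Kv; have [_ ->] := induces_cl gA (cone_neq0 hK Kv).
  by apply: group_domain => //; case: Kv.
have [|hA|hA] := @cone_form_sign R n (cone_over O f) f hK (A *m f).
- move=> v Kv; rewrite /lform mulmxA.
  apply/(affine_patch_cl f (induces_cl gA (cone_neq0 hK Kv)).1)/Of.
  by apply: subset_closure; exact: OA.
- exists A; split => // v Kv; split; last exact: OA.
  by have := hA v Kv; rewrite /lform mulmxA.
exists (- A); split => [|v Kv].
  case: gA => uA gA; split; first by rewrite -scaleN1r unitmxZ// unitfE oppr_eq0 oner_neq0.
  move=> p; have [c c0 cE] := gA p; exists (- c); first by rewrite oppr_eq0.
  by rewrite mulmxN scalerN scaleNr opprK.
split; last by rewrite mulmxN -scaleN1r clZ ?oppr_eq0 ?oner_neq0//; exact: OA.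
by have := hA v Kv; rewrite /lform !mulmxN mulNmx mulmxA.
Qed.

Lemma dist_act g a b : G g -> dist (act g a) (act g b) = dist a b.
Proof.
suff H h x y : G h -> dist (act h x) (act h y) <= dist x y.
  move=> Gg; have [_ _ _ /(_ g Gg)[h [Gh gh _]]] := pcm_is_group M.
  have actK x : act h (act g x) = x.
    by apply: val_inj; rewrite val_act// val_act// gh.
  by apply/eqP; rewrite eq_le H//= -{1}[a]actK -{1}[b]actK H.
move=> Gh; have [f [Of hK rep _]] := pcm_cone.
have [[v Kv vx] [w Kw wy]] := (rep x, rep y).
have [A [hA KA]] := group_cone_matrix Gh Of hK.
have eA u z : cone_over O f u -> cl u = val z -> cl (u *m A) = val (act h z).
  by move=> Ku uz; have [_ ->] := induces_cl hA (cone_neq0 hK Ku); rewrite uz val_act.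
apply/ler_addgt0Pr => e e0.
apply/ltW/(dist_ltP _ Of (KA _ Kv) (KA _ Kw) (eA _ _ Kv vx) (eA _ _ Kw wy)).
by apply: cone_near_map => //; apply/(dist_ltP _ Of Kv Kw vx wy); rewrite ltrDl.
Qed.

(** Otherwise [g] fixes a Hilbert ball pointwise, hence all classes of vectors near a representative
    of [a], and [locally_fixed_id] applies. *)
Lemma nonfixed_near g a r : G g -> g <> idfun -> 0 < r ->
  exists2 b, dist a b < r & act g b <> b.
Proof.
move=> Gg g1 r0; apply: contrapT => hb; apply: g1.
have [f [Of hK rep rep']] := pcm_cone; have [v Kv va] := rep a.
have [A [gA _]] := group_cone_matrix Gg Of hK.
apply: (locally_fixed_id gA (cone_neq0 hK Kv)).
have r1 : 1 < expR r by rewrite -expR0 ltr_expR.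
apply: filterS (cone_near_nbhs hK Kv r1) => w [Kw vw] _.
have [b wb] := rep' _ Kw; rewrite -wb -val_act//; congr val.
apply: contrapT => nb; apply: hb; exists b => //.
by apply/(dist_ltP _ Of Kv Kw va (esym wb)).
Qed.

Lemma group_iter k g : G g -> G (iter k g).
Proof.
have [_ G1 GM _] := pcm_is_group M; move=> Gg.
by elim: k => [|k IH]; [exact: G1|exact: (GM g (iter k g))].
Qed.

Lemma dist_act_iter g a k : G g -> dist a (act (iter k g) a) <= k%:R * dist a (act g a).
Proof.
move=> Gg; elim: k => [|k IH].
  rewrite mul0r (_ : act _ a = a) ?dist_refl//.
  by apply: val_inj; rewrite (val_act a (group_iter 0 Gg)).
rewrite -[act _ a]/(act (g \o iter k g) a) act_comp//; last exact: group_iter.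
apply: le_trans (dist_triangle (act g a) _ _) _; rewrite dist_act//.
by rewrite -natr1 mulrDl mul1r addrC lerD2r.
Qed.

Lemma quotient_dist_lt (x y : orbit_space M) r : quotient_dist x y < r ->
  exists a b, [/\ orbit_proj a = x, orbit_proj b = y & dist a b < r].
Proof.
move=> /inf_lt[|_ [a [b [ax by_ ->]]] ab]; last by exists a, b.
have [[a ax] [b by_]] := (orbit_proj_surj x, orbit_proj_surj y).
by exists (dist a b), a, b.
Qed.

Lemma quotient_dist_lt_lift (x : orbit_space M) b r :
  quotient_dist x (orbit_proj b) < r ->
  exists2 a, orbit_proj a = x & dist a b < r.
Proof.
move=> /quotient_dist_lt[a [b' [ax /orbit_projP[g Gg ->] ab]]].
by exists (act g a); rewrite ?orbit_proj_act// dist_act.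
Qed.

End Manifold.

(** * Tubes *)

Section Tubes.
Context {R : realType} {n : nat}.

(** The first [N] iterates of [a] stay within [D] of [b], as [g] moves [b] little. Packing brings
    two of them close, and cancelling the smaller power leaves [a] and an iterate. [N] does not
    depend on the manifold. *)
Lemma recurrence (D delta : R) : 0 < delta -> exists N : nat,
  forall (M : pcManifold R n) (a b : domain_points M) g, pcm_group M g ->
  hilbert_dist b a + N%:R * hilbert_dist b (act g b) < D ->
  exists2 k : nat, (0 < k)%N & hilbert_dist a (act (iter k g) a) < delta.
Proof.
move=> d0; have [N hN] := @cone_packing R n D delta d0; exists N => M a b g Gg h.
have [f [Of hK rep _]] := pcm_cone M; have [u Ku ub] := rep b.
have /choice[x hx] (j : nat) : exists v : 'rV[R]_n.+1,
    cone_over (pcm_domain M) f v /\ cl v = val (act (iter j g) a).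
  by have [v Kv vj] := rep (act (iter j g) a); exists v.
have [j jN|i [j [ij jN near_ij]]] := hN _ f u x hK Ku.
  have [Kj xj] := hx j; apply/(dist_ltP _ Of Ku Kj ub xj).
  apply: le_lt_trans (dist_triangle (act (iter j g) b) _ _) _.
  rewrite dist_act; last exact: group_iter.
  apply: le_lt_trans h; rewrite addrC lerD2l (le_trans (dist_act_iter _ _ Gg))//.
  by rewrite ler_wpM2r ?dist_ge0// ler_nat.
exists (j - i)%N; first by rewrite subn_gt0.
have [[Ki xi] [Kj xj]] := (hx i, hx j).
have /(dist_ltP _ Of Ki Kj xi xj) := near_ij.
have -> : act (iter j g) a = act (iter i g) (act (iter (j - i) g) a).
  rewrite -act_comp; [|exact: group_iter|exact: group_iter].
  by congr act; apply/funext => p /=; rewrite -iterD subnKC// ltnW.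
by rewrite dist_act//; exact: group_iter.
Qed.

Context (M : pcManifold R n).

(** A larger embedded ball would contain two different points of the same orbit. *)
Lemma inj_radius_le (a : domain_points M) g r : pcm_group M g -> g <> idfun ->
  hilbert_dist a (act g a) < r -> (inj_radius (orbit_proj a) <= r%:E)%E.
Proof.
move=> Gg g1 agr; apply: ge_ereal_sup => _ [s [s0 [a' aa' inj]] <-].
rewrite lee_fin leNgt; apply/negP => rs.
have [h Gh e] := orbit_projP (esym aa').
(* As [g] might a priori fix [a], a nearby point [b] that it moves is used. Within [e0] of [a], both
   [b] and its image are in the ball of radius [s]; [h] carries them to the ball about the given
   lift [a']. *)
pose e0 := s - hilbert_dist a (act g a).
have [|b ab gb] := @nonfixed_near R n M g a e0 Gg g1; first by rewrite /e0; lra.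
apply: gb; have injh : injective (@act R n M h).
  have [_ _ _ /(_ h Gh)[h' [_ hh' _]]] := pcm_is_group M.
  move=> x y /(congr1 val); rewrite !val_act// => /(can_inj hh') xy.
  exact: val_inj.
apply: injh; apply: inj; rewrite ?inE /= ?e ?dist_act//.
- apply: le_lt_trans (dist_triangle (act g a) _ _) _; rewrite dist_act//.
  by move: ab; rewrite /e0; lra.
- apply: lt_le_trans ab _; rewrite /e0 gerBl; exact: dist_ge0.
- by rewrite !orbit_proj_act.
Qed.

Lemma closed_geodesic_shift (c : R -> orbit_space M) l t : simple_closed_geodesic c l ->
  exists b g, [/\ orbit_proj b = c t, pcm_group M g, g <> idfun &
    hilbert_dist b (act g b) = l].
Proof.
move=> [l0 [L [c' [_ _ iso cc']]] per].
have /esym e : c (t + l) = c t by apply/per; exists 1; rewrite mul1r.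
rewrite !cc' in e; have [g Gg eg] := orbit_projP e.
have dl : hilbert_dist (c' t) (act g (c' t)) = l.
  by rewrite -eg iso opprD addNKr normrN gtr0_norm.
exists (c' t), g; split => //; move=> g1.
move: dl l0; rewrite (_ : act g (c' t) = c' t) ?dist_refl; first by move=> ->; rewrite ltxx.
by apply: val_inj; rewrite val_act// g1.
Qed.

Lemma interior_lift_ball (N : set (orbit_space M)) a : interior N (orbit_proj a) ->
  exists2 r : R, 0 < r & forall b, hilbert_dist a b < r -> interior N (orbit_proj b).
Proof.
move=> Na.
have oN : open (interior N) by exact: open_interior.
have [W oW WE] : open (@orbit_proj R n M @^-1` interior N) := oN.
have [|r r0 hr] := @small_dist_nbhs R n M a W.
  apply: open_nbhs_nbhs; split => //.
  by have : (@orbit_proj R n M @^-1` interior N) a by []; rewrite -WE.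
exists r => // b /hr Wb.
have : (set_val @^-1` W) b by [].
by rewrite WE.
Qed.

Lemma geodesic_in_period (c : R -> orbit_space M) l t : simple_closed_geodesic c l ->
  exists2 s, s \in `[0, l] & c s = c t.
Proof.
move=> [l0 _ per]; exists (t - (Num.floor (t / l))%:~R * l).
  have := floor_itv (t / l); rewrite ler_pdivlMr// ltr_pdivrMr// intrD mulrDl mul1r.
  by move=> /andP[? ?]; rewrite in_itv /=; apply/andP; split; lra.
by apply/per; exists (- Num.floor (t / l)); rewrite mulrNz mulNr.
Qed.

(** Around each lifted core point some ball projects into the interior of [N]; compactness of one
    period makes its radius uniform. *)
Lemma tube_depth_gt0 (N : set (orbit_space M)) (c : R -> orbit_space M) l :
  simple_closed_geodesic c l -> range c `<=` interior N ->
  exists2 r : R, 0 < r & forall x t, boundary N x -> r <= quotient_dist x (c t).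
Proof.
move=> geo cN; have [l0 [L [c' [_ _ iso cc']]] per] := geo.
pose P (r t : R) := forall a, hilbert_dist (c' t) a < r -> interior N (orbit_proj a).
have cpt := (compact_near_coveringP _).1 (@segment_compact R 0 l).
have : \forall r \near 0^'+, `[0, l]%classic `<=` P r.
  apply: cpt => t _.
  have [|r r0 hr] := @interior_lift_ball N (c' t); first by rewrite -cc'; apply: cN; exists t.
  (* Half of the radius pays for moving the centre along the geodesic, the other half for the
     ball. *)
  exists ([set s | `|t - s| < r / 2], [set e | e < r / 2]).
    split => /=; last by apply: nbhs_right_lt; rewrite divr_gt0.
    by apply/nbhs_normP; exists (r / 2) => //=; rewrite divr_gt0.
  move=> [s e] /= [ts er] a sa; apply: hr.
  apply: le_lt_trans (dist_triangle (c' s) _ _) _; rewrite iso; lra.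
move=> /(filterI (nbhs_right_gt 0)) /filter_ex[r [r0 hr]]; exists r => // x t [_ nNx].
rewrite leNgt; apply/negP; have [s s0l <-] := geodesic_in_period t geo.
rewrite cc' => /quotient_dist_lt_lift[a ax ad]; apply: nNx; rewrite -ax.
by apply: (hr s) => //; rewrite dist_sym.
Qed.

End Tubes.

Lemma tube_far {R : realType} (n : nat) (mu D : R) : 0 < mu ->
  exists2 eps : R, 0 < eps & forall (M : pcManifold R n) (N : set (orbit_space M)) c l,
  margulis_tube mu N c l -> l < eps ->
  forall x t, boundary N x -> D <= quotient_dist x (c t).
Proof.
move=> mu0; pose delta := iota_margulis n mu / 2.
have delta0 : 0 < delta by rewrite !divr_gt0// exprn_gt0.
have [K hK] := @recurrence R n (D + 1) delta delta0.
(* With this bound, [K] steps along the core have total length below 1, which the radius [D + 1]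
   given to [recurrence] absorbs. *)
exists (K.+1%:R^-1); first by rewrite invr_gt0 ltr0n.
move=> M N c l [geo _ inj] lK x t bx; rewrite leNgt; apply/negP.
have [b [g [bt Gg g1 bl]]] := closed_geodesic_shift t geo.
rewrite -bt => /quotient_dist_lt_lift[a ax ab].
have [|k k0 ak] := hK M a b g Gg.
  rewrite dist_sym bl ltrD//; apply: (@le_lt_trans _ _ (K%:R * K.+1%:R^-1)).
    by rewrite ler_wpM2l// ltW.
  by rewrite ltr_pdivrMr ?ltr0n// mul1r ltr_nat.
(* Torsion-freeness makes the recurrent power nontrivial, so it bounds the injectivity radius by
   [delta], half of the value required on the boundary. *)
have gk1 : iter k g <> idfun.
  by move=> e; apply: g1; exact: (pcm_group_torsion_free Gg k0 e).
have := le_trans (inj x bx) (_ : _ <= delta%:E)%E.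
rewrite lee_fin /delta -ax => /(_ (inj_radius_le (group_iter k Gg) gk1 ak)).
have : 0 < iota_margulis n mu by move: delta0; rewrite /delta; lra.
lra.
Qed.

Theorem proposition0p13 (R : realType) (n : nat) (mu : R)
    (hn : (2 <= n)%N) (hmu : margulis_constant n mu) :
  exists d : R -> R,
    [/\ forall x : R, 0 < x -> x <= mu -> 0 <= d x,
        forall x y : R, 0 < x -> x <= y -> y <= mu -> d y <= d x,
        d x @[x --> 0^'+] --> +oo &
        forall (eps : R), 0 < eps -> eps <= mu ->
          forall (M : pcManifold R n) (N : set (orbit_space M))
            (c : R -> orbit_space M) (l : R),
            margulis_tube mu N c l -> l < eps -> ((d eps)%:E < depth N c)%E].
Proof.
have [mu0 _] := hmu.
pose Good (D eps : R) := forall (M : pcManifold R n) (N : set (orbit_space M)) c l,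
  margulis_tube mu N c l -> l < eps ->
  forall x t, boundary N x -> D <= quotient_dist x (c t).
(* The lower bounds valid for all tubes with core shorter than [eps]. The cap [eps^-1] keeps the
   supremum finite even if there are no such tubes. *)
pose S (eps : R) := [set D : R | [/\ 0 <= D, D <= eps^-1 & Good D eps]].
have S0 eps : 0 < eps -> S eps 0.
  move=> e0; split => [//||M N c l _ _ x t _]; first by rewrite invr_ge0 ltW.
  by rewrite leNgt; apply/negP => /quotient_dist_lt[a [b [_ _]]]; rewrite ltNge dist_ge0.
have Sub eps : has_ubound (S eps) by exists eps^-1 => D [].
have supS0 eps : 0 < eps -> 0 <= sup (S eps) by move=> /S0/(ub_le_sup (Sub eps)).
(* Halving will make the final inequality strict. Monotonicity holds because [S] shrinks as [eps]
   grows. *)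
exists (fun eps => sup (S eps) / 2); split.
- by move=> x x0 _; rewrite divr_ge0// supS0.
- move=> x y x0 xy _; rewrite ler_pM2r//.
  apply: ge_sup; first by exists 0; apply: S0; exact: lt_le_trans xy.
  move=> D [D0 Dy GD]; apply: (ub_le_sup (Sub x)); split => //.
    by rewrite (le_trans Dy)// lef_pV2// posrE (lt_le_trans x0).
  by move=> M N c l tube lx; apply: (GD M N c l tube); exact: lt_le_trans xy.
(* The factor 2 compensates the halving; positivity of [B] lets the cap be met by taking [x] below
   [B^-1]. *)
- apply/cvgryPge => A; pose B := Num.max (2 * A) 1.
  have [e e0 hB] := @tube_far R n mu B mu0.
  have B0 : 0 < B by rewrite lt_max ltr01 orbT.
  near=> x; have x0 : 0 < x by near: x; exact: nbhs_right_gt.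
  rewrite ler_pdivlMr// mulrC (@le_trans _ _ B)//; first by rewrite le_max lexx.
  apply: (ub_le_sup (Sub x)); split; first exact: ltW.
    rewrite -[B]invrK lef_pV2 ?posrE ?invr_gt0//.
    by apply/ltW; near: x; apply: nbhs_right_lt; rewrite invr_gt0.
  move=> M N c l tube lx; apply: (hB M N c l tube); apply: (lt_trans lx).
  by near: x; exact: nbhs_right_lt.
move=> eps e0 _ M N c l tube le; have [geo [cN _] _] := tube.
have [r r0 hr] := tube_depth_gt0 geo cN.
pose s := sup (S eps).
(* If [s] is zero, halving it gains nothing, and strictness comes from the radius [r] of the
   individual tube. *)
have hs x t : boundary N x -> Num.max r s <= quotient_dist x (c t).
  move=> bx; rewrite ge_max hr//=; apply: ge_sup; first by exists 0; exact: S0.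
  by move=> D [_ _ GD]; exact: (GD M N c l tube le).
apply: (@lt_le_trans _ _ (Num.max r s)%:E).
  rewrite lte_fin lt_max; have := supS0 eps e0; rewrite -/s le_eqVlt.
  by move=> /predU1P[<-|s0]; [rewrite mul0r r0|apply/orP; right; lra].
by apply: le_ereal_inf_tmp => _ [x bx [_ [t _ <-] <-]]; rewrite lee_fin; exact: hs.
Unshelve. all: by end_near. Qed.
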